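(* Let $Q_+$ be an affine semigroup with $Q=\mathbb{Z}Q_+\cong\mathbb{Z}^d$, $R=\Bbbk[Q_+]$ with homogeneous maximal ideal $\mathfrak m$. Fix a constructible family $\{M_n\}_{n\in\mathbb{Z}^k}$ of noetherian $Q$-modules and an $\mathfrak m$-primary monomial ideal $I\subseteq R$. For each fixed $i$, the Hilbert coefficients $e_i(I,M_n)$ are piecewise quasipolynomial in $n$ of degree at most $d$.
   Context: $\Bbbk$ is a field; an affine semigroup is a finitely generated submonoid with trivial units of a free abelian group; $Q$ is ordered by $q\preceq q'$ iff $q'-q\in Q_+$; $\mathfrak m$ is spanned by $x^q$, $q\in Q_+\setminus\{0\}$. Semisimple subset: finite disjoint union of sets $q+N$ with $N$ generated by linearly independent elements. A Presburger group is a partially ordered free abelian group of finite rank whose positive cone is semisimple and generates a finite-index subgroup. A module over a Presburger group $G$ is constructible if its graded pieces are finite-dimensional and $G$ can be partitioned into finitely many semisimple regions $I$ with vector spaces $M_I$ and isomorphisms $M_I\to M_g$ ($g\in I$) such that for $g\in I$, $h\in J$, $g\preceq h$, the composite $M_I\to M_g\to M_h\to M_J$ depends only on $I,J$. A family $\{M_n\}_{n\in\mathbb{Z}^k}$ of $Q$-modules is constructible if for some Presburger group $G=\mathbb{Z}^k\times Q$ with positive cone $G_+$ satisfying $G_+\cap(\{0\}\times Q)=\{0\}\times Q_+$, the direct sum $\bigoplus_nM_n(-n)$ (with $M_n$ in slice $\{n\}\times Q$) is a $G$-graded $\Bbbk[G_+]$-module extending the slice structures and is constructible. For a noetherian module $M$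 of Krull dimension $\delta$, the Hilbert–Samuel polynomial $H_{I,M}(m)$ satisfies $\ell(M/I^mM)=H_{I,M}(m)$ for $m\gg0$; writing $H_{I,M}(m)=e_0(I,M)\binom{m+\delta}{\delta}-e_1(I,M)\binom{m+\delta-1}{\delta-1}+\cdots+(-1)^\delta e_\delta(I,M)$ defines the Hilbert coefficients $e_i(I,M)$. Piecewise quasipolynomial of degree at most $d$: finitely many rational convex polyhedra cover $\mathbb{Z}^k$, and on each the function agrees with a function that is a polynomial of degree at most $d$ on each coset of some finite-index sublattice. *)

(* Defs.v *)
From HB Require Import structures.
From mathcomp Require Import all_boot all_order all_algebra.
From mathcomp Require Import mpoly.
Set Implicit Arguments. Unset Strict Implicit. Unset Printing Implicit Defensive.
Import Order.TTheory GRing.Theory Num.Theory.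
Local Open Scope ring_scope.

(* Q = Z^d, elements are row vectors 'rV[int]_d.  The affine semigroup *)
(* Q_+ is given by a finite generating family gens : 'I_r -> Z^d.      *)

Definition in_sg (d r : nat) (gens : 'I_r -> 'rV[int]_d) (p : 'rV[int]_d) : Prop :=
  exists c : 'I_r -> nat, p = \sum_(i < r) gens i *+ c i.

Definition affine_gens (d r : nat) (gens : 'I_r -> 'rV[int]_d) : Prop :=
  (forall p, in_sg gens p -> in_sg gens (- p) -> p = 0) /\
  (forall x : 'rV[int]_d, exists c : 'I_r -> int, x = \sum_(i < r) gens i *~ c i).

(* Q-modules (Q-graded k[Q_+]-modules with finite-dimensional pieces):  *)
(* qdim q = dim M_q, and qact q q' : M_q -> M_q' (row vectors) is       *)
(* multiplication by x^(q'-q), meaningful when q <= q'.               *)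
Record qmod (F : fieldType) (d : nat) := QMod {
  qdim : 'rV[int]_d -> nat;
  qact : forall q q' : 'rV[int]_d, 'M[F]_(qdim q, qdim q')
}.

Definition is_qmod (F : fieldType) (d r : nat) (gens : 'I_r -> 'rV[int]_d)
    (M : qmod F d) : Prop :=
  (forall q, qact M q q = 1%:M) /\
  (forall q q' q'', in_sg gens (q' - q) -> in_sg gens (q'' - q') ->
     qact M q q' *m qact M q' q'' = qact M q q'').

(* finitely generated (= noetherian, R being noetherian): finitely many   *)
(* degrees whose pieces generate M *)
Definition qmod_fg (F : fieldType) (d r : nat) (gens : 'I_r -> 'rV[int]_d)
    (M : qmod F d) : Prop :=
  exists qs : seq 'rV[int]_d, forall q, exists J : seq 'rV[int]_d,
    (forall j, j \in J -> j \in qs /\ in_sg gens (q - j)) /\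
    (1%:M <= \sum_(j <- J) <<qact M j q>>)%MS.

Definition noetherian_qmod (F : fieldType) (d r : nat) (gens : 'I_r -> 'rV[int]_d)
    (M : qmod F d) : Prop := is_qmod gens M /\ qmod_fg gens M.

Definition qzero (F : fieldType) (d : nat) (M : qmod F d) : Prop :=
  forall q, qdim M q = 0%N.

(* Monomial ideals of R = k[Q_+], given by their set E of exponents.   *)
Definition monomial_ideal (d r : nat) (gens : 'I_r -> 'rV[int]_d)
    (E : 'rV[int]_d -> Prop) : Prop :=
  (forall a, E a -> in_sg gens a) /\
  (forall a b, E a -> in_sg gens b -> E (a + b)).

(* m-primary: I is contained in m (1 \notin I) and m \subseteq rad I,   *)
(* i.e. every generator x^p (p in Q_+ \ 0) of m has a power in I.       *)
Definition m_primary (d r : nat) (gens : 'I_r -> 'rV[int]_d)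
    (E : 'rV[int]_d -> Prop) : Prop :=
  ~ E 0 /\ (forall p, in_sg gens p -> p != 0 -> exists n : nat, E (p *+ n.+1)).

Definition pow_exps (d r : nat) (gens : 'I_r -> 'rV[int]_d)
    (E : 'rV[int]_d -> Prop) (m : nat) (a : 'rV[int]_d) : Prop :=
  exists b : 'I_m -> 'rV[int]_d,
    (forall j, E (b j)) /\ in_sg gens (a - \sum_(j < m) b j).

(* c = dim_k (M / I^m M)_q *)
Definition colen_eq (F : fieldType) (d r : nat) (gens : 'I_r -> 'rV[int]_d)
    (E : 'rV[int]_d -> Prop) (M : qmod F d) (m : nat) (q : 'rV[int]_d) (c : nat)
    : Prop :=
  exists J : seq 'rV[int]_d,
    (forall a, a \in J -> pow_exps gens E m a) /\
    (forall a, pow_exps gens E m a ->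
       (qact M (q - a) q <= \sum_(b <- J) <<qact M (q - b) q>>)%MS) /\
    c = (qdim M q - \rank (\sum_(b <- J) <<qact M (q - b) q>>)%MS)%N.

Definition qlength (F : fieldType) (d r : nat) (gens : 'I_r -> 'rV[int]_d)
    (E : 'rV[int]_d -> Prop) (M : qmod F d) (m : nat) (L : nat) : Prop :=
  exists (S : seq 'rV[int]_d) (c : 'rV[int]_d -> nat),
    uniq S /\ (forall q, colen_eq gens E M m q (c q)) /\
    (forall q, q \notin S -> c q = 0%N) /\ L = (\sum_(q <- S) c q)%N.

(* Krull dimension of M = Krull dimension of R / Ann_R(M), computed    *)
(* through the presentation k[X_1..X_r] ->> R, X_i |-> x^(gens i):     *)
(* R/Ann_R(M) = P/Ann_P(M) with P = k[X_1..X_r].                       *)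
Definition mexp (d r : nat) (gens : 'I_r -> 'rV[int]_d) (m : 'X_{1..r}) : 'rV[int]_d :=
  \sum_(i < r) gens i *+ m i.

Definition ann_P (F : fieldType) (d r : nat) (gens : 'I_r -> 'rV[int]_d)
    (M : qmod F d) (f : {mpoly F[r]}) : Prop :=
  forall q q' : 'rV[int]_d, in_sg gens (q' - q) ->
    (\sum_(m <- msupp f | q + mexp gens m == q') f@_m) *: qact M q q' = 0.

Definition prime_ideal (F : fieldType) (r : nat) (P : {mpoly F[r]} -> Prop) : Prop :=
  P 0 /\ (forall f g, P f -> P g -> P (f + g)) /\
  (forall f g, P g -> P (f * g)) /\ ~ P 1 /\
  (forall f g, P (f * g) -> P f \/ P g).

Definition prime_chain (F : fieldType) (d r : nat) (gens : 'I_r -> 'rV[int]_d)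
    (M : qmod F d) (l : nat) : Prop :=
  exists C : nat -> {mpoly F[r]} -> Prop,
    (forall j, (j <= l)%N -> prime_ideal (C j)) /\
    (forall f, ann_P gens M f -> C 0%N f) /\
    (forall j, (j < l)%N ->
       (forall f, C j f -> C j.+1 f) /\ exists f, C j.+1 f /\ ~ C j f).

Definition krull_dim (F : fieldType) (d r : nat) (gens : 'I_r -> 'rV[int]_d)
    (M : qmod F d) (delta : nat) : Prop :=
  prime_chain gens M delta /\ ~ prime_chain gens M delta.+1.

Definition hs_poly (F : fieldType) (d r : nat) (gens : 'I_r -> 'rV[int]_d)
    (E : 'rV[int]_d -> Prop) (M : qmod F d) (delta : nat) (es : nat -> int) : Prop :=
  exists m0 : nat, forall m : nat, (m0 <= m)%N -> exists L : nat,
    qlength gens E M m L /\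
    (L%:Z = \sum_(j < delta.+1)
              (-1) ^+ j * es j * ('C(m + delta - j, delta - j))%:Z).

(* e = e_i(I, M); by convention e_i = 0 for i > dim M, and all e_i = 0  *)
(* for the zero module *)
Definition hilbert_coeff (F : fieldType) (d r : nat) (gens : 'I_r -> 'rV[int]_d)
    (E : 'rV[int]_d -> Prop) (M : qmod F d) (i : nat) (e : int) : Prop :=
  (qzero M -> e = 0) /\
  (forall (delta : nat) (es : nat -> int),
     krull_dim gens M delta -> hs_poly gens E M delta es ->
     e = if (i <= delta)%N then es i else 0).

Section Semisimple.
Variable T : zmodType.

Definition linindep (vs : seq T) : Prop :=
  forall c : nat -> int, \sum_(j < size vs) vs`_j *~ c j = 0 ->
    forall j, (j < size vs)%N -> c j = 0.

Definition in_translate (p : T * seq T) (x : T) : Prop :=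
  exists c : nat -> nat, x = p.1 + \sum_(j < size p.2) p.2`_j *+ c j.

Definition semisimple (S : T -> Prop) : Prop :=
  exists parts : seq (T * seq T),
    (forall j, (j < size parts)%N -> linindep (nth (0, [::]) parts j).2) /\
    (forall i j x, (i < size parts)%N -> (j < size parts)%N -> i <> j ->
       in_translate (nth (0, [::]) parts i) x ->
       in_translate (nth (0, [::]) parts j) x -> False) /\
    (forall x, S x <-> exists2 j, (j < size parts)%N &
                                  in_translate (nth (0, [::]) parts j) x).

Definition presburger_cone (Gp : T -> Prop) : Prop :=
  Gp 0 /\ (forall x y, Gp x -> Gp y -> Gp (x + y)) /\
  (forall x, Gp x -> Gp (- x) -> x = 0) /\
  semisimple Gp /\
  (exists reps : seq T, forall x, exists r0, r0 \in reps /\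
     exists a b, Gp a /\ Gp b /\ x - r0 = a - b).

Definition is_gmod (F : fieldType) (Gp : T -> Prop) (dims : T -> nat)
    (phi : forall g h : T, 'M[F]_(dims g, dims h)) : Prop :=
  (forall g, phi g g = 1%:M) /\
  (forall g h l, Gp (h - g) -> Gp (l - h) -> phi g h *m phi h l = phi g l).

Definition constructible_gmod (F : fieldType) (Gp : T -> Prop) (dims : T -> nat)
    (phi : forall g h : T, 'M[F]_(dims g, dims h)) : Prop :=
  exists (N : nat) (reg : T -> 'I_N) (dI : 'I_N -> nat)
         (psi : forall g, 'M[F]_(dI (reg g), dims g))
         (Tm : forall I J : 'I_N, 'M[F]_(dI I, dI J)),
    (forall I, semisimple (fun g => reg g = I)) /\
    (forall g, row_free (psi g) && row_full (psi g)) /\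
    (forall g h, Gp (h - g) -> psi g *m phi g h = Tm (reg g) (reg h) *m psi h).
End Semisimple.

Definition constructible_family (F : fieldType) (d r k : nat)
    (gens : 'I_r -> 'rV[int]_d) (M : 'rV[int]_k -> qmod F d) : Prop :=
  exists (Gp : 'rV[int]_k * 'rV[int]_d -> Prop)
         (phi : forall g h : 'rV[int]_k * 'rV[int]_d,
                  'M[F]_(qdim (M g.1) g.2, qdim (M h.1) h.2)),
    presburger_cone Gp /\
    (forall q, Gp (0, q) <-> in_sg gens q) /\
    is_gmod Gp phi /\
    (forall n q q', in_sg gens (q' - q) -> phi (n, q) (n, q') = qact (M n) q q') /\
    constructible_gmod Gp phi.

Definition in_polyhedron (k : nat) (P : seq ('rV[rat]_k * rat)) (x : 'rV[int]_k) : Prop :=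
  forall c, c \in P -> \sum_(i < k) c.1 0 i * (x 0 i)%:~R <= c.2.

Definition finite_index_sublattice (k : nat) (L : 'rV[int]_k -> Prop) : Prop :=
  L 0 /\ (forall x y, L x -> L y -> L (x - y)) /\
  exists reps : seq 'rV[int]_k, forall x, exists2 r0, r0 \in reps & L (x - r0).

Definition piecewise_quasipoly (k D : nat) (f : 'rV[int]_k -> int) : Prop :=
  exists Ps : seq (seq ('rV[rat]_k * rat)),
    (forall x, exists2 P, P \in Ps & in_polyhedron P x) /\
    (forall P, P \in Ps -> exists L, finite_index_sublattice L /\
       forall x0, exists p : {mpoly rat[k]}, (msize p <= D.+1)%N /\
         forall x, in_polyhedron P x -> L (x - x0) ->
           (f x)%:~R = p.@[fun i => (x 0 i)%:~R]).

(* Main.v *)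
(* The length of M_n / I^m M_n is the sum over q in Z^d of the colengths
   c(m, n, q) of the pieces of degree q.  By constructibility c(m, n, q) depends
   only on the region of (n, q) and on the set of regions met by (n, q - a) with
   x^a in I^m.  Since I is finitely generated (Dickson) these are Presburger
   conditions, and quantifier elimination makes c a piecewise constant function.
   Summing over the d coordinates of q one at a time raises the degree by one
   each time, so the length is piecewise quasipolynomial in (m, n) of degree at
   most d.  For large m in a fixed residue class it is a polynomial in m with
   piecewise quasipolynomial coefficients, which must be the Hilbert-Samuel
   polynomial; the e_i are backward differences of it at m = -1.  These depend
   on the Krull dimension of M_n, which is the largest rank of a set T of
   generators such that no power of x_T = prod_(i in T) x_i annihilates M_n,
   again a Presburger condition on n.  For the upper bound, successive
   differences of a chain of l primes are algebraically independent modulo the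
   smallest prime, and counting the monomials of bounded degree modulo the
   binomial relations gives l <= rank T.  For the lower bound, if T is maximal,
   the kernels of X_i |-> Y^(pi (gens i)) (i in T), X_i |-> 0 (i not in T), with
   pi running over coordinate projections of decreasing rank, form a chain of
   primes above the annihilator. *)
Require Import Defs.
From HB Require Import structures.
From mathcomp Require Import all_boot all_order all_algebra.
From mathcomp Require Import ssrcomplements mpoly.
From mathcomp Require Import zify ring.
From Stdlib Require Import Classical.
Set Implicit Arguments. Unset Strict Implicit. Unset Printing Implicit Defensive.
Import Order.TTheory GRing.Theory Num.Theory.
Local Open Scope ring_scope.

(** * Presburger predicates and quantifier elimination *)

(** Lengths and Hilbert-Samuel polynomials are given as relations, so the candidate functions are
    built for all integer values of the variables and compared with these relations only where they
    hold. Two obstacles shape the calculus. The colengths have finite support in [q], but no bound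
    for it in terms of (m, n) is given; a sum over one variable is therefore the difference of the
    limits of an antidifference at plus and minus infinity. Likewise polynomial behaviour in m
    starts at a threshold depending on n; but a decision tree stabilizes along the multiples of one
    fixed [N], and as the Hilbert-Samuel function is a genuine polynomial for large m, this single
    residue class determines it. The point -1 is chosen because the polynomial ['C(m + a, a)]
    vanishes at m = -1 for a > 0 and is 1 for a = 0, while a backward difference lowers a by one.
    Neither taking differences nor fixing m raises the total degree in (m, n), so the bound d passes
    to each e_i. *)

Definition env (V : finType) := {ffun V -> int}.

Definition upd (V : finType) (e : env V) (v : V) (x : int) : env V :=
  [ffun u => if u == v then x else e u].

Lemma upd_same V (e : env V) v x : upd e v x v = x.
Proof. by rewrite ffunE eqxx. Qed.

Lemma upd_other V (e : env V) v x u : u != v -> upd e v x u = e u.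
Proof. by move=> uv; rewrite ffunE (negPf uv). Qed.

Lemma upd_upd V (e : env V) v x y : upd (upd e v x) v y = upd e v y.
Proof. by apply/ffunP => u; rewrite !ffunE; case: eqP. Qed.

Lemma upd_id V (e : env V) v : upd e v (e v) = e.
Proof. by apply/ffunP => u; rewrite !ffunE; case: eqP => // ->. Qed.

Section Affine.
Variable V : finType.
Implicit Types (l : env V -> int) (e : env V).

Definition affine l : Prop :=
  exists (c : int) (a : V -> int), forall e, l e = c + \sum_v a v * e v.

Lemma affine_ext l l' : affine l -> l =1 l' -> affine l'.
Proof. by move=> [c [a h]] E; exists c, a => e; rewrite -E h. Qed.

Lemma affine_const c : affine (fun _ => c).
Proof.
by exists c, (fun _ => 0) => e; rewrite big1 ?addr0 // => v _; rewrite mul0r.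
Qed.

Lemma affine_var v : affine (fun e => e v).
Proof.
exists 0, (fun u => (u == v)%:R) => e.
rewrite add0r (bigD1 v) //= eqxx mul1r big1 ?addr0 // => u /negPf ->.
by rewrite mul0r.
Qed.

Lemma affine_add l l' : affine l -> affine l' -> affine (fun e => l e + l' e).
Proof.
move=> [c [a h]] [c' [a' h']]; exists (c + c'), (fun v => a v + a' v) => e.
rewrite h h' addrACA -big_split; congr (_ + _).
by apply: eq_bigr => v _; rewrite mulrDl.
Qed.

Lemma affine_scale b l : affine l -> affine (fun e => b * l e).
Proof.
move=> [c [a h]]; exists (b * c), (fun v => b * a v) => e.
by rewrite h mulrDr mulr_sumr; congr (_ + _); apply: eq_bigr => v _; rewrite mulrA.
Qed.

Lemma affine_opp l : affine l -> affine (fun e => - l e).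
Proof. by move=> /(affine_scale (-1)) h; apply: affine_ext h _ => e; rewrite mulN1r. Qed.

Lemma affine_sub l l' : affine l -> affine l' -> affine (fun e => l e - l' e).
Proof. by move=> h h'; apply: affine_add h (affine_opp h'). Qed.

Lemma affine_sum (I : Type) (r : seq I) (P : pred I) (F : I -> env V -> int) :
  (forall i, affine (F i)) -> affine (fun e => \sum_(i <- r | P i) F i e).
Proof.
move=> h; elim: r => [|i r IH].
  by apply: affine_ext (affine_const 0) _ => e; rewrite big_nil.
case Pi: (P i).
  by apply: affine_ext (affine_add (h i) IH) _ => e; rewrite big_cons Pi.
by apply: affine_ext IH _ => e; rewrite big_cons Pi.
Qed.

Lemma affine_updE l v : affine l -> exists a : int,
  affine (fun e => l (upd e v 0)) /\
  (forall e x, l (upd e v x) = a * x + l (upd e v 0)).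
Proof.
move=> [c [a h]]; exists (a v); split.
  exists c, (fun u => if u == v then 0 else a u) => e; rewrite h; congr (_ + _).
  by apply: eq_bigr => u _; rewrite ffunE; case: eqP; rewrite ?mulr0 ?mul0r.
move=> e x; rewrite !h addrCA; congr (_ + _).
rewrite (bigD1 v) //= upd_same [in RHS](bigD1 v) //= upd_same mulr0 add0r.
by congr (_ + _); apply: eq_bigr => u uv; rewrite !upd_other.
Qed.

End Affine.

Lemma affine_comp (V W : finType) (l : env W -> int) (s : env V -> env W) :
  affine l -> (forall w, affine (fun e => s e w)) -> affine (fun e => l (s e)).
Proof.
move=> [c [a h]] hs; apply: (@affine_ext _ (fun e => c + \sum_w a w * s e w)).
  apply: affine_add (affine_const _ _) (affine_sum _ _ _) => w.
  exact: affine_scale.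
by move=> e; rewrite h.
Qed.

Inductive atom (V : finType) (P : env V -> bool) : Prop :=
| atom_le l : affine l -> P =1 (fun e => 0 <= l e) -> atom P
| atom_dvd (m : nat) l : (0 < m)%N -> affine l ->
    P =1 (fun e => (m%:Z %| l e)%Z) -> atom P.

Inductive pres (V : finType) : (env V -> bool) -> Prop :=
| pres_atom P : atom P -> pres P
| pres_neg P : pres P -> pres (fun e => ~~ P e)
| pres_and P Q : pres P -> pres Q -> pres (fun e => P e && Q e)
| pres_ext P Q : pres P -> P =1 Q -> pres Q.

Lemma pres_const (V : finType) b : pres (fun _ : env V => b).
Proof.
have h : pres (fun _ : env V => true).
  by apply/pres_atom/(atom_le (affine_const V 0)).
by case: b; [exact: h | apply: (pres_ext (pres_neg h))].
Qed.

Lemma pres_or (V : finType) (P Q : env V -> bool) :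
  pres P -> pres Q -> pres (fun e => P e || Q e).
Proof.
move=> hP hQ; apply: (pres_ext (pres_neg (pres_and (pres_neg hP) (pres_neg hQ)))).
by move=> e /=; rewrite negb_and !negbK.
Qed.

(* The fractions [s e u / a] are integers, equal to [w u]. *)
Definition scaled_subst (V W : finType) (a : int) (s : env V -> env W)
    (e : env V) (w : env W) : Prop := forall u, a * w u = s e u.

Lemma affine_scaled (V W : finType) (a : int) (s : env V -> env W) (l : env W -> int) :
  (forall w, affine (fun e => s e w)) -> affine l ->
  exists2 l', affine l' & forall e w, scaled_subst a s e w -> a * l w = l' e.
Proof.
move=> hs [c [b lE]]; exists (fun e => a * c + \sum_w b w * s e w).
  apply: affine_add (affine_const _ _) (affine_sum _ _ _) => w.
  exact: affine_scale.
move=> e w h; rewrite lE mulrDr mulr_sumr; congr (_ + _).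
by apply: eq_bigr => u _; rewrite -h mulrCA.
Qed.

(** Multiplying a test by [a > 0] keeps signs and turns divisibility by [m] into divisibility by
    [a * m], so a test at the fractions [s e / a] becomes a test on the numerators. *)
Lemma atom_subst (V W : finType) (P : env W -> bool) (a : int) (s : env V -> env W) :
  0 < a -> (forall w, affine (fun e => s e w)) -> atom P ->
  exists2 P', atom P' & forall e w, scaled_subst a s e w -> P w = P' e.
Proof.
move=> a0 hs [l /(affine_scaled a hs)[l' hl E] PE|m l m0 /(affine_scaled a hs)[l' hl E] PE].
- exists (fun e => 0 <= l' e); first exact: atom_le hl _.
  by move=> e w /E <-; rewrite PE pmulr_rge0.
- exists (fun e => ((`|a| * m)%N%:Z %| l' e)%Z).
    by apply: (@atom_dvd _ _ (`|a| * m)%N) hl _ => //; rewrite muln_gt0 absz_gt0 m0 gt_eqF.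
  move=> e w /E <-; rewrite PE PoszM abszE gtr0_norm // dvdz_mul2l ?gt_eqF //.
Qed.

Lemma pres_subst (V W : finType) (P : env W -> bool) (a : int) (s : env V -> env W) :
  0 < a -> (forall w, affine (fun e => s e w)) -> pres P ->
  exists2 P', pres P' & forall e w, scaled_subst a s e w -> P w = P' e.
Proof.
move=> a0 hs; elim=> {P} [P /(atom_subst a0 hs)[P' h E]|P _ [P' h E]
  |P Q _ [P' h E] _ [Q' h' E']|P Q _ [P' h E] PQ].
- by exists P' => //; apply: pres_atom.
- by exists (fun e => ~~ P' e) => [|e w /E ->//]; apply: pres_neg.
- exists (fun e => P' e && Q' e) => [|e w d]; first exact: pres_and.
  by rewrite (E _ _ d) (E' _ _ d).
- by exists P' => // e w /E <-.
Qed.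

Lemma affine_upd (V : finType) (l : env V -> int) (v : V) u :
  affine l -> affine (fun e => upd e v (l e) u).
Proof.
move=> h; case: (altP (u =P v)) => [->|uv].
  by apply: affine_ext h _ => e; rewrite upd_same.
by apply: affine_ext (affine_var u) _ => e; rewrite upd_other.
Qed.

(** These are the numerators when [l e / a] is substituted for [v]: all other coordinates are
    multiplied by [a] too, so that one denominator serves them all. *)
Lemma affine_scale_upd (V : finType) (a : int) (l : env V -> int) (v : V) u :
  affine l -> affine (fun e => (upd [ffun w => a * e w] v (l e) : env V) u).
Proof.
move=> h; case: (altP (u =P v)) => [->|uv].
  by apply: affine_ext h _ => e; rewrite upd_same.
by apply: affine_ext (affine_scale a (affine_var u)) _ => e; rewrite upd_other ?ffunE.
Qed.

Lemma scaled_subst_upd (V : finType) (a : int) (l : env V -> int) (v : V) e y :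
  a * y = l e ->
  scaled_subst a (fun e : env V => upd [ffun w => a * e w] v (l e)) e (upd e v y).
Proof.
move=> h u; case: (altP (u =P v)) => [->|uv]; first by rewrite !upd_same.
by rewrite !upd_other ?ffunE.
Qed.

Lemma linear_sign_eventually (b c : int) (t : nat) :
  b != 0 -> (`|c|%N < t)%N -> (0 <= b * t%:Z + c) = (0 < b).
Proof.
move=> b0 ct; case: ltP => b1.
  have h : 1 * t%:Z <= b * t%:Z by apply: ler_wpM2r; lia.
  by apply/idP; lia.
have h : b * t%:Z <= -1 * t%:Z by apply: ler_wpM2r; lia.
lia.
Qed.

Lemma dvdzDr (d m n : int) : (d %| n)%Z -> (d %| m + n)%Z = (d %| m)%Z.
Proof. exact: rpredDr. Qed.

(** * Limits of Presburger predicates along arithmetic progressions *)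

Section Limits.
Variables (V : finType) (v : V).

(** Along [j + s * t] an inequality that really depends on [v] ends with the sign of its slope, and
    a divisibility by [m] repeats with period [m]. [N] is chosen before [s] and [j], so it serves
    all residues and both directions. *)
Lemma atom_limit (P : env V -> bool) : atom P ->
  exists2 N : nat, (0 < N)%N & forall s j : int, s != 0 -> exists P' : env V -> bool,
    [/\ atom P', forall e x, P' (upd e v x) = P' e &
    forall e, exists t0 : nat, forall t : nat, (t0 <= t)%N -> (N %| t)%N ->
      P (upd e v (j + s * t%:Z)) = P' e].
Proof.
have cst (b : bool) : atom (fun _ : env V => b).
  case: b; first exact: (atom_le (affine_const V 0)).
  exact: (atom_le (affine_const V (-1))).
case=> [l /(affine_updE v)[a [hl lE]] PE|m l m0 /(affine_updE v)[a [hl lE]] PE].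
- exists 1%N => // s j s0.
  have [a0|a0] := eqVneq (a * s) 0.
    exists (fun e => 0 <= l (upd e v 0)); split.
    + exact: atom_le hl _.
    + by move=> e x; rewrite upd_upd.
    have {}a0 : a = 0 by move/eqP: a0; rewrite mulf_eq0 (negPf s0) orbF => /eqP.
    by move=> e; exists 0%N => t _ _; rewrite PE lE a0 mul0r add0r.
  exists (fun _ => 0 < a * s); split; [exact: cst | by [] |].
  move=> e; exists `|a * j + l (upd e v 0)|.+1 => t ht _; rewrite PE lE.
  by rewrite mulrDr mulrA addrAC addrC linear_sign_eventually.
- exists m => // s j s0; exists (fun e => (m%:Z %| a * j + l (upd e v 0))%Z); split.
  + by apply: atom_dvd m0 (affine_add (affine_const _ _) hl) _.
  + by move=> e x; rewrite upd_upd.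
  move=> e; exists 0%N => t _ mt; rewrite PE lE mulrDr addrAC dvdzDr //.
  by rewrite mulrA dvdz_mull.
Qed.

Lemma pres_limit (P : env V -> bool) : pres P ->
  exists2 N : nat, (0 < N)%N & forall s j : int, s != 0 -> exists P' : env V -> bool,
    pres P' /\
    forall e, exists t0 : nat, forall t : nat, (t0 <= t)%N -> (N %| t)%N ->
      P (upd e v (j + s * t%:Z)) = P' e.
Proof.
elim=> {P} [P /atom_limit[N N0 h]|P _ [N N0 h]|P Q _ [N N0 h] _ [N' N0' h']|P Q _ [N N0 h] PQ].
- by exists N => // s j /(h s j)[P' [hP _ E]]; exists P'; split => //; apply: pres_atom.
- exists N => // s j /(h s j)[P' [hP E]]; exists (fun e => ~~ P' e); split.
    exact: pres_neg.
  by move=> e; have [t0 Et] := E e; exists t0 => t le /(Et _ le) ->.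
- exists (N * N')%N => [|s j s0]; first by rewrite muln_gt0 N0.
  have [P' [hP E]] := h s j s0; have [Q' [hQ E']] := h' s j s0.
  exists (fun e => P' e && Q' e); split; first exact: pres_and.
  move=> e; have [t0 Et] := E e; have [t1 Et'] := E' e; exists (maxn t0 t1) => t.
  rewrite geq_max => /andP[le le'] dv; rewrite Et ?Et' //.
    exact: dvdn_trans (dvdn_mull _ _) dv.
  exact: dvdn_trans (dvdn_mulr _ _) dv.
- exists N => // s j /(h s j)[P' [hP E]]; exists P'; split => //.
  by move=> e; have [t0 Et] := E e; exists t0 => t le /(Et _ le) <-.
Qed.

End Limits.

(** * Quantifier elimination *)

Section QuantifierElimination.
Variables (V : finType).
Implicit Types (A B : env V -> Prop).

Definition definable A : Prop := exists2 P, pres P & forall e, P e <-> A e.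

Lemma definable_ext A B : definable A -> (forall e, A e <-> B e) -> definable B.
Proof. by move=> [P hP E] AB; exists P => // e; rewrite E. Qed.

Lemma definable_const (p : Prop) : definable (fun _ => p).
Proof.
case: (classic p) => hp; first by exists (fun _ => true); [exact: pres_const|].
by exists (fun _ => false); [exact: pres_const|].
Qed.

Lemma definable_and A B : definable A -> definable B -> definable (fun e => A e /\ B e).
Proof.
move=> [P hP E] [Q hQ E']; exists (fun e => P e && Q e); first exact: pres_and.
by move=> e; rewrite -E -E'; split => /andP.
Qed.

Lemma definable_or A B : definable A -> definable B -> definable (fun e => A e \/ B e).
Proof.
move=> [P hP E] [Q hQ E']; exists (fun e => P e || Q e); first exact: pres_or.
by move=> e; rewrite -E -E'; split => /orP.
Qed.

Lemma definable_not A : definable A -> definable (fun e => ~ A e).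
Proof.
move=> [P hP E]; exists (fun e => ~~ P e); first exact: pres_neg.
by move=> e; rewrite -E; split => /negP.
Qed.

Lemma definable_imp A B : definable A -> definable B -> definable (fun e => A e -> B e).
Proof.
move=> hA hB; apply: definable_ext (definable_or (definable_not hA) hB) _ => e.
by split=> [[]//|h]; case: (classic (A e)) => [/h|]; [right|left].
Qed.

Lemma definable_le l l' : affine l -> affine l' -> definable (fun e => l e <= l' e).
Proof.
move=> h h'; exists (fun e => 0 <= l' e - l e); last by move=> e; rewrite subr_ge0.
exact/pres_atom/(atom_le (affine_sub h' h)).
Qed.

Lemma definable_eq l l' : affine l -> affine l' -> definable (fun e => l e = l' e).
Proof.
move=> h h'; apply: definable_ext (definable_and (definable_le h h') (definable_le h' h)) _.
by move=> e; split=> [[h1 h2]|->//]; apply/eqP; rewrite eq_le h1.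
Qed.

Lemma definable_all_seq (I : eqType) (r : seq I) (A : I -> env V -> Prop) :
  (forall i, definable (A i)) -> definable (fun e => forall i, i \in r -> A i e).
Proof.
move=> h; elim: r => [|i r IH]; first exact: definable_ext (definable_const True) _.
apply: definable_ext (definable_and (h i) IH) _ => e; split=> [[Ai H] j|H].
  by rewrite inE => /orP[/eqP->|/H].
by split=> [|j jr]; apply: H; rewrite inE ?eqxx ?jr ?orbT.
Qed.

Lemma definable_all_fin (I : finType) (A : I -> env V -> Prop) :
  (forall i, definable (A i)) -> definable (fun e => forall i, A i e).
Proof.
move=> h; apply: definable_ext (definable_all_seq (enum I) h) _ => e.
by split=> H i; [apply: H; rewrite mem_enum | move=> _; apply: H].
Qed.

Lemma definable_ex_fin (I : finType) (A : I -> env V -> Prop) :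
  (forall i, definable (A i)) -> definable (fun e => exists i, A i e).
Proof.
move=> h; apply: definable_ext (definable_not (definable_all_fin (fun i => definable_not (h i)))) _.
by move=> e; split=> [/not_all_not_ex//|[i Ai] /(_ i)].
Qed.

(* The places where a Presburger predicate of [y] may fail to be periodic:
   finitely many rational affine functions [y = l e / a] of the other variables. *)
Inductive breakset : (env V -> int -> Prop) -> Prop :=
| breakset0 : breakset (fun _ _ => False)
| breakset1 (a : int) l : 0 < a -> affine l -> breakset (fun e y => a * y = l e)
| breaksetU R S : breakset R -> breakset S -> breakset (fun e y => R e y \/ S e y).

Lemma breakset_range (a : int) l n : 0 < a -> affine l ->
  exists2 S, breakset S & forall e y (i : nat), (i < n)%N -> a * y = l e + i%:Z -> S e y.
Proof.
move=> a0 hl; elim: n => [|n [S hS E]].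
  by exists (fun _ _ => False) => //; exact: breakset0.
exists (fun e y => a * y = l e + n%:Z \/ S e y) => [|e y i].
  by apply: breaksetU hS; apply: breakset1 => //; apply: affine_add hl (affine_const _ _).
by rewrite ltnS leq_eqVlt => /orP[/eqP->|lt] h; [left|right; exact: E h].
Qed.

Lemma breakset_shift R c : breakset R ->
  exists2 S, breakset S & forall e y, R e (y - c) -> S e y.
Proof.
elim=> {R} [|a l a0 hl|R S _ [R' hR E] _ [S' hS E']].
- by exists (fun _ _ => False) => //; exact: breakset0.
- exists (fun e y => a * y = l e + a * c) => [|e y <-].
    by apply: breakset1 => //; apply: affine_add hl (affine_const _ _).
  by rewrite mulrBr subrK.
- by exists (fun e y => R' e y \/ S' e y) => [|e y [/E|/E']]; [exact: breaksetU|left|right].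
Qed.

(** Replacing a period by [n] times itself means making [n] successive steps, and the breakpoints of
    each of them have to be collected. *)
Lemma breakset_shifts R c n : breakset R ->
  exists2 S, breakset S & forall e y i, (i < n)%N -> R e (y - c *+ i) -> S e y.
Proof.
move=> hR; elim: n => [|n [S hS E]].
  by exists (fun _ _ => False) => //; exact: breakset0.
have [S' hS' E'] := breakset_shift (c *+ n) hR.
exists (fun e y => S' e y \/ S e y) => [|e y i]; first exact: breaksetU.
by rewrite ltnS leq_eqVlt => /orP[/eqP->|lt] h; [left; exact: E'|right; exact: E h].
Qed.

Variable v : V.

Lemma breakset_atom (P : env V -> bool) : atom P -> exists2 N : nat, (0 < N)%N &
  exists2 R, breakset R & forall e y,
    P (upd e v y) = P (upd e v (y - N%:Z)) \/ R e y.
Proof.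
case=> [l /(affine_updE v)[a [hl lE]] PE|m l m0 /(affine_updE v)[a [hl lE]] PE]; last first.
  exists m => //; exists (fun _ _ => False); first exact: breakset0.
  move=> e y; left; rewrite !PE (lE e y) (lE e (y - m%:Z)) mulrBr addrAC.
  by rewrite -mulrN [RHS]dvdzDr // dvdz_mull // dvdzE abszN dvdnn.
exists 1%N => //.
have [a0|a0] := eqVneq a 0.
  exists (fun _ _ => False); first exact: breakset0.
  by move=> e y; left; rewrite !PE (lE e y) (lE e (y - _)) a0 !mul0r.
have a1 : 0 < `|a| by rewrite normr_gt0.
(* If the sign of [a * y + c] changes between [y - 1] and [y], then [a * y + c] has absolute value
   at most [|a|], and [|a| * y] equals [- Num.sg a * c] plus that absolute value. The bound is
   attained only for negative [a], hence the successor. *)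
have [S hS E] := breakset_range `|a|.+1 a1 (affine_scale (- Num.sg a) hl).
exists S => // e y; rewrite !PE (lE e y) (lE e (y - _)); set c := l _.
have [//|d] := eqVneq (0 <= a * y + c) (0 <= a * (y - 1%:Z) + c); first by left.
right; move: d; rewrite mulrBr mulr1 => d; have [lt|lt] := ltrP a 0.
  apply: (E e y (absz (a * y + c))); first lia.
  rewrite ltr0_norm // ltr0_sg // mulNr opprK mul1r -/c; lia.
have {}lt : 0 < a by rewrite lt_def a0.
apply: (E e y (absz (a * y + c))); first lia.
rewrite gtr0_norm // gtr0_sg // mulN1r -/c; lia.
Qed.

Lemma pres_breakset (P : env V -> bool) : pres P -> exists2 N : nat, (0 < N)%N &
  exists2 R, breakset R & forall e y,
    P (upd e v y) = P (upd e v (y - N%:Z)) \/ R e y.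
Proof.
(* A change over a step of length [N * n] is a change over one of [n] steps of length [N]. This
   brings the two members of a conjunction to a common period. *)
have mult (N n : nat) Q R S : (forall e y i, (i < n)%N -> R e (y - N%:Z *+ i) -> S e y) ->
    (forall e y, Q (upd e v y) = Q (upd e v (y - N%:Z)) \/ R e y) ->
    forall e y, Q (upd e v y) = Q (upd e v (y - (N * n)%N%:Z)) :> bool \/ S e y.
  elim: n => [|n IH] RS h e y; first by left; rewrite muln0 subr0.
  have [|E|] := IH _ h e y; [|have [E'|r] := h e (y - (N * n)%N%:Z)|by right].
  - by move=> e' y' i lt; apply: RS; apply: ltnW.
  - by left; rewrite E E' mulnSr PoszD opprD addrA.
  - by right; apply: (RS e y n) => //; rewrite pmulrn -mulrzr intz -PoszM.
elim=> {P} [P /breakset_atom//|P _ [N N0 [R hR E]]|P Q _ [N N0 [R hR E]] _ [N' N0' [R' hR' E']]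
  |P Q _ [N N0 [R hR E]] PQ].
- by exists N => //; exists R => // e y; case: (E e y) => [->|]; [left|right].
- have [S hS RS] := breakset_shifts N%:Z N' hR.
  have [S' hS' RS'] := breakset_shifts N'%:Z N hR'.
  exists (N * N')%N; first by rewrite muln_gt0 N0.
  exists (fun e y => S e y \/ S' e y); first exact: breaksetU.
  move=> e y; have [->|] := mult _ _ _ _ _ RS E e y; last by right; left.
  by have [|] := mult _ _ _ _ _ RS' E' e y; [rewrite mulnC => ->; left|right; right].
- by exists N => //; exists R => // e y; rewrite -!PQ.
Qed.

Lemma definable_ex_break (P : env V -> bool) R : pres P -> breakset R ->
  definable (fun e => exists2 y, R e y & P (upd e v y)).
Proof.
move=> hP; elim=> {R} [|a l a0 hl|R S _ hR _ hS].
- by apply: definable_ext (definable_const False) _ => e; split=> // -[].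
(* At the breakpoint [y = l e / a] the quantifier becomes a substitution, together with the
   divisibility that makes [y] an integer. *)
- have [P' hP' E] := pres_subst a0 (fun u => affine_scale_upd a v u hl) hP.
  have hd : pres (fun e => (`|a|%N%:Z %| l e)%Z).
    by apply: pres_atom; apply: (@atom_dvd _ _ `|a|%N l) => //; rewrite absz_gt0 gt_eqF.
  exists (fun e => (`|a|%N%:Z %| l e)%Z && P' e); first exact: pres_and.
  move=> e; split=> [/andP[/dvdzP[y yE] p]|[y ay p]].
    have ay : a * y = l e by rewrite yE mulrC abszE gtr0_norm.
    by exists y => //; rewrite (E e) //; apply: scaled_subst_upd.
  by rewrite -ay abszE gtr0_norm // dvdz_mulr // -(E _ _ (scaled_subst_upd v ay)).
- apply: definable_ext (definable_or hR hS) _ => e.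
  split=> [[[y]|[y]]|[y [r|s] p]]; first by exists y => //; left.
  + by exists y => //; right.
  + by left; exists y.
  + by right; exists y.
Qed.

(* Cooper's argument: going down from a solution in steps of [N], either one
   meets a breakpoint that is a solution or one stays among the solutions. *)
Lemma definable_ex1 A : definable A -> definable (fun e => exists y, A (upd e v y)).
Proof.
move=> [P hP PA].
have [N N0 hlim] := pres_limit v hP.
have [M M0 [R hR brk]] := pres_breakset hP.
(* The alternative at minus infinity: all points [j - t] with [N] dividing [t] and [t] large are
   solutions. *)
have hj j : definable (fun e => exists t0 : nat, forall t : nat, (t0 <= t)%N -> (N %| t)%N ->
      P (upd e v (j + -1 * t%:Z))).
  have [//|P' [hP' E]] := hlim (-1) j.
  exists P' => // e; have [t0 Et] := E e; split=> [p|[t1 H]].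
    by exists t0 => t le dv; rewrite Et.
  rewrite -(Et (N * maxn t0 t1)%N) ?dvdn_mulr // ?H ?dvdn_mulr //.
    by rewrite (leq_trans (leq_maxr t0 t1)) // leq_pmull.
  by rewrite (leq_trans (leq_maxl t0 t1)) // leq_pmull.
apply: definable_ext (definable_or (definable_ex_break hP hR)
  (@definable_ex_fin 'I_N _ (fun j => hj (j : nat)%:Z))) _ => e; split.
  case=> [[y _ p]|[j [t0 H]]]; first by exists y; rewrite -PA.
  exists (j%:Z + -1 * (N * t0)%N%:Z); rewrite -PA; apply: H; last exact: dvdn_mulr.
  exact: leq_pmull.
move=> [y]; rewrite -PA => p.
case: (classic (exists i : nat, ~~ P (upd e v (y - (M * i)%N%:Z)))) => [ex|all].
  left; case: (ex_minnP ex) => -[|i]; first by rewrite muln0 subr0 p.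
  move=> np min; have pi : P (upd e v (y - (M * i)%N%:Z)).
    by apply/negPn/negP => /min; rewrite ltnn.
  exists (y - (M * i)%N%:Z) => //; case: (brk e (y - (M * i)%N%:Z)) => //.
  by rewrite pi -addrA -opprD -PoszD -mulnSr (negPf np).
have {}all i : P (upd e v (y - (M * i)%N%:Z)).
  by apply/negPn/negP => h; apply: all; exists i.
right; have Nz : N%:Z != 0 by rewrite eqz_nat -lt0n.
have lt : (`|(y %% N%:Z)%Z| < N)%N by rewrite -ltz_nat gez0_abs ?modz_ge0 // ltz_mod.
have [//|P' [hP' E]] := hlim (-1) (y %% N%:Z)%Z; have [t0 Et] := E e.
exists (Ordinal lt), t0 => t le dv /=.
have yE := divz_eq y N%:Z; set q := (y %/ N%:Z)%Z in yE; set j := (y %% N%:Z)%Z in yE t le dv Et *.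
(* With this [i] the point [y - N * i] lies both on the chain of solutions below [y] with step [M]
   and on the progression below [j] with step [N], there beyond the threshold [t0]. It therefore
   decides the limit. *)
set i := (M * (t0 + `|q|))%N.
have ge : (t0 + `|q| <= i)%N by rewrite leq_pmull.
have t1E : (N * `|i%:Z - q|)%N%:Z = (N * i)%N%:Z - N%:Z * q.
  by rewrite PoszM gez0_abs ?mulrBr ?PoszM //; lia.
rewrite gez0_abs ?modz_ge0 // Et // -(Et (N * `|i%:Z - q|)%N).
- rewrite t1E mulN1r opprB addrA [j + _]addrC mulrC -yE /i mulnCA; exact: all.
- by rewrite (leq_trans _ (leq_pmull _ N0)) //; lia.
- exact: dvdn_mulr.
Qed.

End QuantifierElimination.

Lemma definable_comp (V W : finType) (A : env W -> Prop) (s : env V -> env W) :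
  (forall w, affine (fun e => s e w)) -> definable A -> definable (fun e => A (s e)).
Proof.
move=> hs [P hP E]; have [P' hP' E'] := pres_subst ltr01 hs hP.
by exists P' => // e; rewrite -E -(E' e (s e)) // => u; rewrite mul1r.
Qed.

Definition join (V W : finType) (e : env V) (w : env W) : env (V + W)%type :=
  [ffun u => match u with inl x => e x | inr y => w y end].

(** The variables of [W] are eliminated one by one: for a list [s] the quantifier ranges over the
    environments that may differ from [e] only at variables in [s]. Once all of [W] is covered, the
    values on [W] no longer matter and are set to 0. *)
Lemma definable_ex (V W : finType) (A : env V -> env W -> Prop) :
  definable (fun e : env (V + W)%type => A [ffun x => e (inl x)] [ffun y => e (inr y)]) ->
  definable (fun e => exists w, A e w).
Proof.
set B := (fun e : env (V + W)%type => _) => hB.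
have h (s : seq W) : definable (fun e : env (V + W)%type => exists2 e', B e' &
    forall u, (if u is inr y then y \notin s else true) -> e' u = e u).
  elim: s => [|y s IH].
    apply: definable_ext hB _ => e; split=> [b|[e' b /(_ _) E]]; first by exists e.
    by have <- : e' = e by apply/ffunP => -[x|y]; exact: E.
  apply: definable_ext (definable_ex1 (inr y) IH) _ => e; split.
    move=> [x [e' b E]]; exists e' => // -[u|u] h; rewrite E ?upd_other //.
      by move: h; rewrite inE negb_or => /andP[].
    by move: h; rewrite inE negb_or => /andP[].
  move=> [e' b E]; exists (e' (inr y)), e' => // u h.
  have [->|ne] := eqVneq u (inr y); first by rewrite upd_same.
  rewrite upd_other // E //; case: u h ne => // u h ne.
  by rewrite inE negb_or h andbT; apply: contra ne => /eqP ->.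
apply: definable_ext (@definable_comp V _ _ (fun e => join e [ffun=> 0]) _ (h (enum W))) _.
  case=> x; first by apply: affine_ext (affine_var x) _ => e; rewrite ffunE.
  by apply: affine_ext (affine_const _ 0) _ => e; rewrite !ffunE.
move=> e; split=> [[e' b E]|[w a]].
  exists [ffun y => e' (inr y)]; rewrite /B in b.
  suff <- : [ffun x => e' (inl x)] = e by [].
  by apply/ffunP => x; rewrite ffunE E // ffunE.
exists (join e w) => [|[x _|y]]; last by rewrite mem_enum.
  by rewrite /B; congr A: a; apply/ffunP => x; rewrite !ffunE.
by rewrite !ffunE.
Qed.

(** * Piecewise quasipolynomials *)

Inductive poly_fun (V : finType) : nat -> (env V -> rat) -> Prop :=
| poly_fun_const c : poly_fun 0 (fun _ => c)
| poly_fun_var v : poly_fun 1 (fun e => (e v)%:~R)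
| poly_fun_add D f g : poly_fun D f -> poly_fun D g -> poly_fun D (fun e => f e + g e)
| poly_fun_mul D D' f g : poly_fun D f -> poly_fun D' g ->
    poly_fun (D + D') (fun e => f e * g e)
| poly_fun_leq D D' f : (D <= D')%N -> poly_fun D f -> poly_fun D' f
| poly_fun_ext D f g : poly_fun D f -> f =1 g -> poly_fun D g.

Section PolyFun.
Variables V : finType.
Implicit Types (f g : env V -> rat).

Lemma poly_fun_cst D c : poly_fun D (fun _ : env V => c).
Proof. exact: poly_fun_leq (leq0n D) (poly_fun_const _ c). Qed.

Lemma poly_fun_scale D c f : poly_fun D f -> poly_fun D (fun e => c * f e).
Proof. by move=> h; have := poly_fun_mul (poly_fun_const V c) h. Qed.

Lemma poly_fun_sum D (I : Type) (r : seq I) (P : pred I) (F : I -> env V -> rat) :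
  (forall i, P i -> poly_fun D (F i)) -> poly_fun D (fun e => \sum_(i <- r | P i) F i e).
Proof.
move=> h; elim: r => [|i r IH].
  by apply: poly_fun_ext (poly_fun_cst D 0) _ => e; rewrite big_nil.
case Pi: (P i).
  by apply: poly_fun_ext (poly_fun_add (h i Pi) IH) _ => e; rewrite big_cons Pi.
by apply: poly_fun_ext IH _ => e; rewrite big_cons Pi.
Qed.

Lemma poly_fun_exp D f i : poly_fun D f -> poly_fun (i * D) (fun e => f e ^+ i).
Proof.
move=> h; elim: i => [|i IH].
  by apply: poly_fun_ext (poly_fun_cst _ 1) _ => e; rewrite expr0.
by rewrite mulSn; apply: poly_fun_ext (poly_fun_mul h IH) _ => e; rewrite exprS.
Qed.

Lemma poly_fun_affine (l : env V -> int) : affine l -> poly_fun 1 (fun e => (l e)%:~R).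
Proof.
move=> [c [a E]].
have h : poly_fun 1 (fun e => c%:~R + \sum_v (a v)%:~R * (e v)%:~R).
  apply: poly_fun_add (poly_fun_cst _ _) (poly_fun_sum _ _) => v _.
  exact: poly_fun_scale (poly_fun_var v).
apply: poly_fun_ext h _ => e; rewrite E rmorphD rmorph_sum; congr (_ + _).
by apply: eq_bigr => v _; rewrite rmorphM.
Qed.

Lemma poly_fun_horner D (p : {poly rat}) v :
  (size p <= D.+1)%N -> poly_fun D (fun e : env V => p.[(e v)%:~R]).
Proof.
move=> h; have s : poly_fun D (fun e : env V => \sum_(i < size p) p`_i * (e v)%:~R ^+ i).
  apply: poly_fun_sum => i _; apply: poly_fun_scale.
  apply: poly_fun_leq (poly_fun_exp i (poly_fun_var v)).
  by rewrite muln1 -ltnS (leq_trans _ h).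
by apply: poly_fun_ext s _ => e; rewrite horner_coef.
Qed.

Lemma poly_fun_in_var D f v : poly_fun D f ->
  forall e, exists p : {poly rat}, forall y, f (upd e v y) = p.[y%:~R].
Proof.
move=> h e; elim: h => {D f} [c|u|D f g _ [p E] _ [q E']|D D' f g _ [p E] _ [q E']|//|].
- by exists c%:P => y; rewrite hornerC.
- have [->|uv] := eqVneq u v; first by exists 'X => y; rewrite upd_same hornerX.
  by exists (e u)%:~R%:P => y; rewrite upd_other // hornerC.
- by exists (p + q) => y; rewrite hornerD E E'.
- by exists (p * q) => y; rewrite hornerM E E'.
- by move=> D f g _ [p E] fg; exists p => y; rewrite -fg.
Qed.

End PolyFun.

Lemma poly_fun_subst (V W : finType) (a : int) (s : env V -> env W) D f :
  0 < a -> (forall w, affine (fun e => s e w)) -> poly_fun D f ->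
  exists2 g, poly_fun D g & forall e w, scaled_subst a s e w -> f w = g e.
Proof.
move=> a0 hs; elim=> {D f} [c|u|D f g _ [f' hf E] _ [g' hg E']
  |D D' f g _ [f' hf E] _ [g' hg E']|D D' f DD _ [f' hf E]|D f g _ [f' hf E] fg].
- by exists (fun _ => c) => //; exact: poly_fun_const.
- exists (fun e => a%:~R^-1 * (s e u)%:~R) => [|e w h].
    exact: poly_fun_scale (poly_fun_affine (hs u)).
  by rewrite -h rmorphM mulKf // intr_eq0 gt_eqF.
- exists (fun e => f' e + g' e) => [|e w h]; first exact: poly_fun_add.
  by rewrite (E _ _ h) (E' _ _ h).
- exists (fun e => f' e * g' e) => [|e w h]; first exact: poly_fun_mul.
  by rewrite (E _ _ h) (E' _ _ h).
- by exists f' => //; exact: poly_fun_leq hf.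
- by exists f' => // e w h; rewrite -fg (E _ _ h).
Qed.

(** Strong induction: [x ^+ i.+1 - (x - 1) ^+ i.+1] is [i.+1] times [x ^+ i] plus terms of lower
    degree, for which antidifferences are known. *)
Lemma faulhaber i : exists2 S : {poly rat}, (size S <= i.+2)%N &
  forall x, S.[x] - S.[x - 1] = x ^+ i.
Proof.
elim/ltn_ind: i => i IH.
have low (p : {poly rat}) : (size p <= i)%N ->
    exists2 S : {poly rat}, (size S <= i.+1)%N & forall x, S.[x] - S.[x - 1] = p.[x].
  move=> sp; suff [S sS E] : exists2 S : {poly rat}, (size S <= i.+1)%N &
      forall x, S.[x] - S.[x - 1] = \sum_(j <- iota 0 (size p)) p`_j * x ^+ j.
    exists S => // x; rewrite E horner_coef -(big_mkord xpredT (fun j => p`_j * x ^+ j)).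
    by rewrite /index_iota subn0.
  have : forall j, j \in iota 0 (size p) -> (j < i)%N.
    by move=> j; rewrite mem_iota add0n => /andP[_ /leq_trans]; exact.
  elim: (iota _ _) => [|j r IHr] lt.
    by exists 0 => [|x]; rewrite ?size_poly0 // !horner0 big_nil subrr.
  have [|S sS E] := IHr; first by move=> k kr; apply: lt; rewrite inE kr orbT.
  have [|T sT E'] := IH j; first by apply: lt; rewrite inE eqxx.
  exists (p`_j *: T + S) => [|x].
    rewrite (leq_trans (size_polyD _ _)) // geq_max sS andbT.
    rewrite (leq_trans (size_scale_leq _ _)) // (leq_trans sT) //.
    by apply: lt; rewrite inE eqxx.
  by rewrite big_cons -E -E' !hornerD !hornerZ; ring.
(* [q] holds these lower terms: in the binomial expansion both ['X^(i.+1)] and ['X^i] cancel. *)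
pose q : {poly rat} := 'X^(i.+1) - ('X - 1%:P) ^+ i.+1 - 'X^i *+ i.+1.
have [|S sS E] := low q.
  have -> : q = - \sum_(j < i) 'X^(i - j.+1) * (-1) ^+ j.+2 *+ 'C(i.+1, j.+2).
    rewrite /q exprDn !big_ord_recl /= /bump /= subn0 expr0 mulr1 bin0 bin1 mulr1n.
    rewrite subn1 /= expr1 mulrN1 mulNrn.
    rewrite (eq_bigr (fun j : 'I_i => 'X^(i - j.+1) * (-1) ^+ j.+2 *+ 'C(i.+1, j.+2))).
      by ring.
    by move=> j _; rewrite !add1n subSS polyC1.
  rewrite size_polyN (leq_trans (size_sum _ _ _)) //; apply/bigmax_leqP => j _.
  have -> : 'X^(i - j.+1) * (-1) ^+ j.+2 *+ 'C(i.+1, j.+2) =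
      ((-1) ^+ j.+2 *+ 'C(i.+1, j.+2) : rat) *: 'X^(i - j.+1) :> {poly rat}.
    by rewrite -mul_polyC rmorphMn rmorphXn rmorphN1 mulrC mulrnAl.
  rewrite (leq_trans (size_scale_leq _ _)) // size_polyXn.
  by have := ltn_ord j; lia.
exists ((i.+1)%:R^-1 *: ('X^(i.+1) - S)) => [|x].
  rewrite (leq_trans (size_scale_leq _ _)) // (leq_trans (size_polyD _ _)) //.
  by rewrite size_polyXn size_polyN geq_max leqnn (leq_trans sS).
have := E x; rewrite /q !hornerD !hornerN !horner_exp !hornerMn !horner_exp.
rewrite !hornerD !hornerN !hornerX !hornerC => Ex.
apply: (@mulfI _ i.+1%:R); first by rewrite pnatr_eq0.
rewrite !hornerZ -mulrBr mulVKf ?pnatr_eq0 // !hornerD !hornerN !hornerXn.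
transitivity (x ^+ i.+1 - (x - 1) ^+ i.+1 - (S.[x] - S.[x - 1])); first by ring.
by rewrite Ex mulr_natl; ring.
Qed.

Section Antidifference.
Variables (V : finType) (v : V).

Definition dec (e : env V) : env V := upd e v (e v - 1).

Lemma dec_upd e y : dec (upd e v y) = upd e v (y - 1).
Proof. by rewrite /dec upd_upd upd_same. Qed.

Lemma upd_dec e y : upd (dec e) v y = upd e v y.
Proof. by rewrite /dec upd_upd. Qed.

(** Powers of [v] with coefficients free of [v], the degrees of both counted together. On this form
    an antidifference in [v] acts on the power alone and costs one degree in total. *)
Inductive poly_in (D : nat) : (env V -> rat) -> Prop :=
| poly_in_monom i D' q : (i + D' <= D)%N -> poly_fun D' q ->
    (forall e x, q (upd e v x) = q e) -> poly_in D (fun e => (e v)%:~R ^+ i * q e)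
| poly_in_add f g : poly_in D f -> poly_in D g -> poly_in D (fun e => f e + g e)
| poly_in_ext f g : poly_in D f -> f =1 g -> poly_in D g.

Lemma poly_in_leq D D' f : (D <= D')%N -> poly_in D f -> poly_in D' f.
Proof.
move=> le; elim=> {f} [i D2 q le' hq E|f g _ hf _ hg|f g _ hf fg].
- exact: poly_in_monom (leq_trans le' le) hq E.
- exact: poly_in_add.
- exact: poly_in_ext hf fg.
Qed.

Lemma poly_in_mul D D' f g : poly_in D f -> poly_in D' g ->
  poly_in (D + D') (fun e => f e * g e).
Proof.
move=> hf hg; elim: hf => {f} [i D2 q le hq E|f f' _ hf _ hf'|f f' _ hf ff']; last first.
- by apply: poly_in_ext hf _ => e; rewrite ff'.
- by apply: poly_in_ext (poly_in_add hf hf') _ => e; rewrite mulrDl.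
elim: hg => {g} [j D3 p le' hp E'|g g' _ hg _ hg'|g g' _ hg gg']; last first.
- by apply: poly_in_ext hg _ => e; rewrite gg'.
- by apply: poly_in_ext (poly_in_add hg hg') _ => e; rewrite mulrDr.
have h : poly_in (D + D') (fun e => (e v)%:~R ^+ (i + j) * (q e * p e)).
  apply: poly_in_monom (poly_fun_mul hq hp) _; last by move=> e x; rewrite E E'.
  by rewrite addnACA leq_add.
by apply: poly_in_ext h _ => e; rewrite exprD mulrACA.
Qed.

Lemma poly_fun_in D f : poly_fun D f -> poly_in D f.
Proof.
elim=> {D f} [c|u|D f g _ hf _ hg|D D' f g _ hf _ hg|D D' f le _|D f g _ hf fg].
- have h : poly_in 0 (fun e => (e v)%:~R ^+ 0 * c).
    by apply: poly_in_monom (poly_fun_const V c) _.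
  by apply: poly_in_ext h _ => e; rewrite mul1r.
- have [->|uv] := eqVneq u v.
    have h : poly_in 1 (fun e => (e v)%:~R ^+ 1 * 1).
      by apply: poly_in_monom (poly_fun_const V 1) _.
    by apply: poly_in_ext h _ => e; rewrite mulr1.
  have h : poly_in 1 (fun e => (e v)%:~R ^+ 0 * (e u)%:~R).
    by apply: poly_in_monom (poly_fun_var u) _ => // e x; rewrite upd_other.
  by apply: poly_in_ext h _ => e; rewrite mul1r.
- exact: poly_in_add.
- exact: poly_in_mul.
- exact: poly_in_leq.
- exact: poly_in_ext fg.
Qed.

Lemma poly_fun_antidiff D f : poly_fun D f ->
  exists2 g, poly_fun D.+1 g & forall e, g e - g (dec e) = f e.
Proof.
move=> /poly_fun_in; elim=> {f} [i D' q le hq E|f g _ [f' hf Ef] _ [g' hg Eg]|f g _ [f' hf Ef] fg].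
- have [S sS ES] := faulhaber i; exists (fun e : env V => S.[(e v)%:~R] * q e).
    apply: poly_fun_leq (poly_fun_mul (poly_fun_horner v sS) hq).
    by rewrite addSn ltnS.
  by move=> e; rewrite /dec E upd_same -mulrBl -ES rmorphB.
- exists (fun e => f' e + g' e) => [|e]; first exact: poly_fun_add.
  by rewrite -Ef -Eg; ring.
- by exists f' => // e; rewrite -fg.
Qed.

End Antidifference.

(* Piecewise quasipolynomials as decision trees: inequalities and
   divisibilities at the nodes, polynomials of degree at most [D] at the leaves. *)
Inductive pwq (V : finType) (D : nat) : (env V -> rat) -> Prop :=
| pwq_leaf f : poly_fun D f -> pwq D f
| pwq_if P f g h : atom P -> pwq D f -> pwq D g ->
    h =1 (fun e => if P e then f e else g e) -> pwq D h.

Section Pwq.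
Variable V : finType.
Implicit Types (f g h : env V -> rat).

Lemma pwq_ext D f g : pwq D f -> f =1 g -> pwq D g.
Proof.
case=> {f} [f hf|P f1 f2 f hP h1 h2 E] fg.
  exact/pwq_leaf/(poly_fun_ext hf fg).
by apply: pwq_if hP h1 h2 _ => e; rewrite -fg E.
Qed.

Lemma pwq_op1 D D' (op : rat -> rat) f :
  (forall f, poly_fun D f -> poly_fun D' (fun e : env V => op (f e))) ->
  pwq D f -> pwq D' (fun e => op (f e)).
Proof.
move=> hop; elim=> {f} [f /hop|P f g h hP _ h1 _ h2 E]; first exact: pwq_leaf.
by apply: pwq_if hP h1 h2 _ => e; rewrite E; case: (P e).
Qed.

Lemma pwq_op2 D D' (op : rat -> rat -> rat) f g :
  (forall f g, poly_fun D f -> poly_fun D g -> poly_fun D' (fun e : env V => op (f e) (g e))) ->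
  pwq D f -> pwq D g -> pwq D' (fun e => op (f e) (g e)).
Proof.
move=> hop hf hg; elim: hf => {f} [f hf|P f f' h hP _ h1 _ h2 E]; last first.
  by apply: pwq_if hP h1 h2 _ => e; rewrite E; case: (P e).
elim: hg => {g} [g hg|P g g' h hP _ h1 _ h2 E]; first exact/pwq_leaf/hop.
by apply: pwq_if hP h1 h2 _ => e; rewrite E; case: (P e).
Qed.

Lemma pwq_add D f g : pwq D f -> pwq D g -> pwq D (fun e => f e + g e).
Proof. by apply: pwq_op2; exact: poly_fun_add. Qed.

Lemma pwq_scale D c f : pwq D f -> pwq D (fun e => c * f e).
Proof. by apply: pwq_op1 => f'; exact: poly_fun_scale. Qed.

Lemma pwq_sub D f g : pwq D f -> pwq D g -> pwq D (fun e => f e - g e).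
Proof.
move=> hf /(pwq_scale (-1)) hg; apply: pwq_ext (pwq_add hf hg) _ => e.
by rewrite mulN1r.
Qed.

Lemma pwq_const D c : pwq D (fun _ : env V => c).
Proof. exact/pwq_leaf/poly_fun_cst. Qed.

Lemma pwq_sum D (I : Type) (r : seq I) (P : pred I) (F : I -> env V -> rat) :
  (forall i, P i -> pwq D (F i)) -> pwq D (fun e => \sum_(i <- r | P i) F i e).
Proof.
move=> h; elim: r => [|i r IH].
  by apply: pwq_ext (pwq_const D 0) _ => e; rewrite big_nil.
case Pi: (P i).
  by apply: pwq_ext (pwq_add (h i Pi) IH) _ => e; rewrite big_cons Pi.
by apply: pwq_ext IH _ => e; rewrite big_cons Pi.
Qed.

Lemma pwq_if_pres D P f g : pres P -> pwq D f -> pwq D g ->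
  pwq D (fun e => if P e then f e else g e).
Proof.
move=> hP; elim: hP f g => {P} [P hP|P _ IH|P Q _ IHP _ IHQ|P Q _ IH PQ] f g hf hg.
- exact: pwq_if hP hf hg _.
- by apply: pwq_ext (IH g f hg hf) _ => e; case: (P e).
- by apply: pwq_ext (IHP _ g (IHQ f g hf hg) hg) _ => e; case: (P e); case: (Q e).
- by apply: pwq_ext (IH f g hf hg) _ => e; rewrite PQ.
Qed.

End Pwq.

Lemma pwq_subst (V W : finType) (a : int) (s : env V -> env W) D f :
  0 < a -> (forall w, affine (fun e => s e w)) -> pwq D f ->
  exists2 g, pwq D g & forall e w, scaled_subst a s e w -> f w = g e.
Proof.
move=> a0 hs; elim=> {f} [f /(poly_fun_subst a0 hs)[g hg E]|P f g h hP _ [f' hf E] _ [g' hg E'] hE].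
  by exists g => //; exact: pwq_leaf.
have [P' hP' EP] := atom_subst a0 hs hP.
exists (fun e => if P' e then f' e else g' e); first exact: pwq_if hP' hf hg _.
by move=> e w d; rewrite hE (EP _ _ d) (E _ _ d) (E' _ _ d).
Qed.

Lemma pwq_comp (V W : finType) (s : env V -> env W) D f :
  (forall w, affine (fun e => s e w)) -> pwq D f -> pwq D (fun e => f (s e)).
Proof.
move=> hs hf; have [g hg E] := pwq_subst ltr01 hs hf.
by apply: pwq_ext hg _ => e; rewrite -(E e (s e)) // => u; rewrite mul1r.
Qed.

(** * Antidifferences and sums of piecewise quasipolynomials *)

Section PwqSum.
Variables (V : finType) (v : V).
Notation dec := (dec v).

(** On the class where [l e] has residue [n] modulo [a], the quotient is the exact fraction
    [(l e - n) / a] and can be substituted. The induction adds one residue at a time as a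
    divisibility node. *)
Lemma pwq_floor D f (a : int) l : 0 < a -> affine l -> pwq D f ->
  pwq D (fun e : env V => f (upd e v (l e %/ a)%Z)).
Proof.
move=> a0 hl hf.
suff h n : (n <= `|a|)%N -> exists2 g, pwq D g &
    forall e, ((l e %% a)%Z < n%:Z) -> g e = f (upd e v (l e %/ a)%Z).
  have [g hg E] := h _ (leqnn `|a|%N); apply: pwq_ext hg _ => e.
  by apply: E; rewrite gez0_abs ?ltz_mod ?ltz_pmod // ltW.
elim: n => [_|n IH na].
  by exists (fun _ => 0) => [|e]; [exact: pwq_const | rewrite ltNge modz_ge0 // gt_eqF].
have [g hg E] := IH (ltnW na).
have hl' := affine_sub hl (affine_const _ n%:Z).
have [g' hg' E'] := pwq_subst a0 (fun u => affine_scale_upd a v u hl') hf.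
have hP : atom (fun e => (`|a|%N%:Z %| l e - n%:Z)%Z).
  by apply: (@atom_dvd _ _ `|a|%N _ _ hl') => //; rewrite absz_gt0 gt_eqF.
exists (fun e => if (`|a|%N%:Z %| l e - n%:Z)%Z then g' e else g e).
  exact: pwq_if hP hg' hg _.
have aE : `|a|%N%:Z = a by rewrite gez0_abs // ltW.
have lE e := divz_eq (l e) a.
move=> e lt; rewrite aE; have [dv|ndv] := boolP (a %| l e - n%:Z)%Z.
  have ne : (l e %% a)%Z = n%:Z.
    have /dvdzP[q /(canRL (subrK _)) ->] := dv; rewrite modzMDl modz_small //.
    by rewrite /= -aE ltz_nat.
  symmetry; apply: E'; apply: scaled_subst_upd.
  by rewrite {2}(lE e) ne addrK mulrC.
apply: E; suff : (l e %% a)%Z != n%:Z by move: lt; lia.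
apply: contra ndv => /eqP <-; rewrite {1}(lE e) addrK; exact: dvdz_mull.
Qed.

(* Above the threshold [s] continue the antidifference [g2] by [g1],
   shifted so that both agree at [s]. *)
Lemma pwq_glue D (a : int) l g1 g2 (f1 f2 h : env V -> rat) (c : env V -> bool) :
  0 < a -> affine l -> pwq D g1 -> pwq D g2 ->
  (forall e, g1 e - g1 (dec e) = if c e then f1 e else 0) ->
  (forall e, g2 e - g2 (dec e) = if c e then f2 e else 0) ->
  (forall e, h e = if 0 <= a * e v + l (upd e v 0) then f1 e else f2 e) ->
  exists2 g, pwq D g & forall e, g e - g (dec e) = if c e then h e else 0.
Proof.
move=> a0 hl0 h1 h2 E1 E2 hE.
have [b [hl lE]] := affine_updE v hl0.
(* The largest value of [v] at which the test still fails. *)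
pose s e := ((- l (upd e v 0) - 1) %/ a)%Z.
have hs : affine (fun e => - l (upd e v 0) - 1).
  by apply: affine_sub (affine_const _ _); apply: affine_opp.
have hP : pres (fun e => 0 <= a * e v + l (upd e v 0)).
  apply: pres_atom; apply: atom_le (affine_add (affine_scale a (affine_var v)) hl) _.
  by [].
have thr e y : (0 <= a * y + l (upd e v 0)) = (s e < y).
  rewrite /s; have := divz_eq (- l (upd e v 0) - 1) a.
  have := modz_ge0 (- l (upd e v 0) - 1) (lt0r_neq0 a0).
  have := ltz_pmod (- l (upd e v 0) - 1) a0.
  set q := (_ %/ _)%Z; set r := (_ %% _)%Z; set z := l _ => ra r0 E.
  have [qy|qy] := ltrP q y.
    have : (q + 1) * a <= y * a by rewrite ler_pM2r //; lia.
    by rewrite mulrDl mul1r => ?; apply/idP; lia.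
  have : y * a <= q * a by rewrite ler_pM2r.
  by move=> ?; apply/negbTE; lia.
exists (fun e : env V => if 0 <= a * e v + l (upd e v 0)
    then g1 e - g1 (upd e v (s e)) + g2 (upd e v (s e)) else g2 e).
  exact: pwq_if_pres hP
    (pwq_add (pwq_sub h1 (pwq_floor a0 hs h1)) (pwq_floor a0 hs h2)) h2.
move=> e; have sd : s (dec e) = s e by rewrite /s upd_dec.
rewrite !thr sd hE thr !upd_dec /dec upd_same -/(dec e).
case: (ltrP (s e) (e v)) => se; last first.
  by rewrite ltNge (le_trans _ se) ?E2 //; lia.
case: (ltrP (s e) (e v - 1)) => se'; first by rewrite -E1; ring.
have -> : s e = e v - 1 by lia.
by rewrite -/(dec e) -E1; ring.
Qed.

(** The restriction to a residue class of [v] is what makes the induction pass divisibility nodes: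
    on a fine enough class such a test no longer depends on [v]. *)
Lemma pwq_antidiff D f : pwq D f -> forall (M : nat) (j : int), (0 < M)%N ->
  exists2 g, pwq D.+1 g &
    forall e, g e - g (dec e) = if (M%:Z %| e v - j)%Z then f e else 0.
Proof.
elim=> {f} [f hf|P f1 f2 h hP _ IH1 _ IH2 hE] M j M0.
  (* At a leaf put [v = M * x + j] and take the antidifference in [x]. Composed with the floor of
     [(v - j) / M] it jumps exactly on the class of [j]. *)
  have aff w : affine (fun e : env V => upd e v (M%:Z * e v + j) w).
    apply: affine_upd; apply: affine_add (affine_const _ _).
    exact: affine_scale (affine_var v).
  have [f' hf' Ef] := poly_fun_subst ltr01 aff hf.
  have {}Ef e : f (upd e v (M%:Z * e v + j)) = f' e.
    by apply: Ef => u; rewrite mul1r.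
  have [g hg E] := poly_fun_antidiff v hf'.
  have M1 : 0 < M%:Z by rewrite ltz_nat.
  exists (fun e : env V => g (upd e v ((e v - j) %/ M%:Z)%Z)).
    apply: pwq_floor => //; last exact: pwq_leaf.
    exact: affine_sub (affine_var v) (affine_const _ _).
  move=> e; rewrite upd_dec /dec upd_same.
  have E1 := divz_eq (e v - j) M%:Z; case: ifPn => [/dvdzP[q qE]|ndv].
    rewrite qE mulzK ?gt_eqF //.
    have -> : ((e v - 1 - j) %/ M%:Z)%Z = q - 1.
      have -> : e v - 1 - j = (q - 1) * M%:Z + (M%:Z - 1) by rewrite mulrBl -qE; ring.
      rewrite divzMDl ?gt_eqF // divz_small ?addr0 //; apply/andP; split; lia.
    have := E (upd e v q); rewrite dec_upd => ->; rewrite -Ef upd_upd upd_same.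
    by congr f; rewrite mulrC -qE subrK upd_id.
  have r0 : (e v - j) %% M%:Z != 0 :> int by apply: contra ndv => /eqP/dvdz_mod0P.
  have -> : ((e v - 1 - j) %/ M%:Z)%Z = ((e v - j) %/ M%:Z)%Z.
    have := modz_ge0 (e v - j) (lt0r_neq0 M1); have := ltz_pmod (e v - j) M1.
    move: E1 r0; set r := (_ %% _)%Z; set q := (_ %/ _)%Z => E1 r0 r1 r2.
    have -> : e v - 1 - j = q * M%:Z + (r - 1) by lia.
    rewrite divzMDl ?gt_eqF // divz_small ?addr0 //; apply/andP; split; lia.
  by rewrite subrr.
case: hP => [l hl PE|m l m0 hl PE]; have [a [hl0 lE]] := affine_updE v hl.
  have {}lE e : l e = a * e v + l (upd e v 0) by rewrite -{1}(upd_id e v) lE.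
  have [g1 h1 E1] := IH1 M j M0; have [g2 h2 E2] := IH2 M j M0.
  have [a0|a0|a0] := ltrgtP a 0.
  (* For a negative slope the test is replaced by its integer complement [0 <= - l e - 1] and the
     branches are exchanged, so that gluing only meets positive slopes. *)
  - have a1 : 0 < - a by rewrite oppr_gt0.
    have aff : affine (fun e => - l e - 1).
      exact: affine_sub (affine_opp hl) (affine_const _ _).
    apply: (pwq_glue a1 aff h2 h1 E2 E1) => e; rewrite hE PE (lE e) mulNr.
    move: (a * e v) (l (upd e v 0)) => x y.
    have -> : (0 <= - x + (- y - 1)) = ~~ (0 <= x + y) by lia.
    by case: ifP.
  - by apply: (pwq_glue a0 hl h1 h2 E1 E2) => e; rewrite hE PE (lE e).
  - have hP : pres (fun e => 0 <= l (upd e v 0)) by apply: pres_atom; exact: atom_le hl0 _.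
    exists (fun e : env V => if 0 <= l (upd e v 0) then g1 e else g2 e); first exact: pwq_if_pres.
    move=> e; rewrite upd_dec hE PE (lE e) a0 mul0r add0r.
    by case: ifP => _; [rewrite E1|rewrite E2].
have {}lE e : l e = a * e v + l (upd e v 0) by rewrite -{1}(upd_id e v) lE.
have MM : (0 < M * m)%N by rewrite muln_gt0 M0.
(* On each class modulo [M * m] the test is the one with [v] replaced by [i], hence constant in
   [v]. *)
have hG (i : 'I_(M * m)) : exists2 g, pwq D.+1 g & forall e, g e - g (dec e) =
    if ((M * m)%N%:Z %| e v - i%:Z)%Z then h e else 0.
  have [g1 h1 E1] := IH1 _ i%:Z MM; have [g2 h2 E2] := IH2 _ i%:Z MM.
  have hP : pres (fun e => (m%:Z %| a * i%:Z + l (upd e v 0))%Z).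
    apply: pres_atom; apply: atom_dvd m0 (affine_add (affine_const _ _) hl0) _.
    by [].
  exists (fun e : env V => if (m%:Z %| a * i%:Z + l (upd e v 0))%Z then g1 e else g2 e).
    exact: pwq_if_pres.
  move=> e; rewrite upd_dec hE PE (lE e).
  have [dv|ndv] := boolP ((M * m)%N%:Z %| e v - i%:Z)%Z; last first.
    by case: ifP => _; rewrite ?E1 ?E2 (negPf ndv).
  have -> : (m%:Z %| a * e v + l (upd e v 0))%Z = (m%:Z %| a * i%:Z + l (upd e v 0))%Z.
    have -> : a * e v + l (upd e v 0) =
      a * i%:Z + l (upd e v 0) + a * (e v - i%:Z) by ring.
    rewrite dvdzDr // dvdz_mull // (dvdz_trans _ dv) // PoszM; exact: dvdz_mull.
  by case: ifP => _; rewrite ?E1 ?E2 dv.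
have [G hG1 hG2] := fin_all_exists2 hG.
(* The class of [j] modulo [M] is the disjoint union of these classes modulo [M * m]; at any [e] at
   most one summand jumps. *)
exists (fun e : env V => \sum_(i < M * m | (M%:Z %| i%:Z - j)%Z) G i e).
  by apply: pwq_sum => i _.
move=> e; rewrite -sumrB (eq_bigr _ (fun i _ => hG2 i e)).
have MM1 : 0 < (M * m)%N%:Z by rewrite ltz_nat.
have lt : (`|(e v %% (M * m)%N%:Z)%Z| < M * m)%N.
  by rewrite -ltz_nat gez0_abs ?modz_ge0 ?gt_eqF // ltz_pmod.
have iE : (Ordinal lt : nat)%:Z = (e v %% (M * m)%N%:Z)%Z.
  by rewrite /= gez0_abs // modz_ge0 // gt_eqF.
have dvE : ((M * m)%N%:Z %| e v - (Ordinal lt : nat)%:Z)%Z.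
  by rewrite iE {1}(divz_eq (e v) (M * m)%N%:Z) addrK dvdz_mull.
have uni (i : 'I_(M * m)) : i != Ordinal lt -> ((M * m)%N%:Z %| e v - i%:Z)%Z = false.
  apply: contraNF => /dvdzP[q /(canRL (subrK _)) E]; rewrite -val_eqE -eqz_nat iE E.
  by rewrite modzMDl modz_small // /= ltz_nat ltn_ord.
have Mdv : (M%:Z %| (Ordinal lt : nat)%:Z - j)%Z = (M%:Z %| e v - j)%Z.
  have -> : e v - j = (Ordinal lt : nat)%:Z - j + (e v - (Ordinal lt : nat)%:Z) by ring.
  by rewrite [RHS]dvdzDr // (dvdz_trans _ dvE) // PoszM dvdz_mulr.
case: ifPn => dv; last first.
  rewrite big1 // => i di; rewrite uni //; apply: contraNneq dv => ie.
  by rewrite -Mdv -ie.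
rewrite (bigD1 (Ordinal lt)) ?Mdv //= -[X in (_ %| _ - X%:Z)%Z]/(nat_of_ord (Ordinal lt)).
rewrite dvE big1 ?addr0 // => i /andP[_ ie]; by rewrite uni.
Qed.

End PwqSum.

Lemma poly_eventually_eq (p q : {poly rat}) (s : int) (N t0 : nat) :
  s != 0 -> (0 < N)%N ->
  (forall t : nat, (t0 <= t)%N -> (N %| t)%N ->
     p.[(s * t%:Z)%:~R] = q.[(s * t%:Z)%:~R]) -> p = q.
Proof.
move=> s0 N0 h; apply/eqP; rewrite -subr_eq0; apply/negPn/negP => pq.
pose rs : seq rat := [seq (s * (N * (t0 + i))%N%:Z)%:~R | i <- iota 0 (size (p - q))].
have : (size rs < size (p - q)%R)%N.
  apply: max_poly_roots => //.
    apply/allP => _ /mapP[i _ ->]; rewrite rootE hornerD hornerN h ?subrr ?dvdn_mulr //.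
    by rewrite (leq_trans (leq_addr i t0)) // leq_pmull.
  rewrite map_inj_uniq ?iota_uniq // => i j /intr_inj /(mulfI s0) [] /eqP.
  by rewrite eqn_pmul2l // eqn_add2l => /eqP.
by rewrite size_map size_iota ltnn.
Qed.

Lemma big_uniq_support (R : nmodType) (T : eqType) (r s : seq T) (F : T -> R) :
  uniq r -> uniq s -> {subset s <= r} -> (forall y, y \notin s -> F y = 0) ->
  \sum_(y <- r) F y = \sum_(y <- s) F y.
Proof.
move=> ur us sr F0; rewrite (bigID (mem s)) /= [X in _ + X]big1 ?addr0 //.
rewrite -big_filter; apply/perm_big/uniq_perm; rewrite ?filter_uniq // => y.
by rewrite mem_filter; apply: andb_idr; exact: sr.
Qed.

Section Summation.
Variables (V : finType) (v : V).

(** Far out along the multiples of [N] every test has its limiting value, so one leaf survives and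
    the function is a polynomial in [v]. Which leaf survives is again decided by tests on the other
    variables, so the limit keeps the form and the degree. *)
Lemma pwq_limit D f (s : int) : s != 0 -> pwq D f -> exists2 h : env V -> rat, pwq D h &
  (forall e, exists p : {poly rat}, forall y, h (upd e v y) = p.[y%:~R]) /\
  exists2 N : nat, (0 < N)%N & forall e, exists t0 : nat, forall t : nat,
    (t0 <= t)%N -> (N %| t)%N -> f (upd e v (s * t%:Z)) = h (upd e v (s * t%:Z)).
Proof.
move=> s0; elim=> {f} [f hf|P f1 f2 f hP _ [h1 p1 [q1 [N1 N10 E1]]] _ [h2 p2 [q2 [N2 N20 E2]]] fE].
  exists f; first exact: pwq_leaf.
  split; first exact: poly_fun_in_var hf.
  by exists 1%N => // e; exists 0%N.
have [N N0 hN] := atom_limit v hP; have [P' [hP' inv EP]] := hN s 0 s0.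
exists (fun e => if P' e then h1 e else h2 e); first exact: pwq_if hP' p1 p2 _.
split=> [e|].
  have [p Ep] := q1 e; have [q Eq] := q2 e.
  by exists (if P' e then p else q) => y; rewrite inv Ep Eq; case: (P' e).
exists (N * (N1 * N2))%N => [|e]; first by rewrite !muln_gt0 N0 N10.
have [t0 Et] := EP e; have [t1 Et1] := E1 e; have [t2 Et2] := E2 e.
exists (maxn t0 (maxn t1 t2)) => t; rewrite !geq_max => /and3P[l0 l1 l2] dv.
have d0 : (N %| t)%N := dvdn_trans (dvdn_mulr _ (dvdnn _)) dv.
have d12 : (N1 * N2 %| t)%N := dvdn_trans (dvdn_mull _ (dvdnn _)) dv.
rewrite fE inv -(Et t) // add0r; case: ifP => _.
  exact/Et1/(dvdn_trans _ d12)/dvdn_mulr.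
exact/Et2/(dvdn_trans _ d12)/dvdn_mull.
Qed.

(** For finite support the antidifference is constant beyond the support on either side. The two
    limiting polynomials in [v] are then these constants and can be read off at 0, so the bound [b]
    on the support occurs only in the verification. *)
Lemma pwq_sum_var D f : pwq D f -> exists2 g : env V -> rat, pwq D.+1 g &
  forall e (s : seq int), uniq s -> (forall y, y \notin s -> f (upd e v y) = 0) ->
    g e = \sum_(y <- s) f (upd e v y).
Proof.
move=> hf; have [G hG EG] := pwq_antidiff v hf 0 (ltn0Sn 0).
have {}EG e y : G (upd e v y) - G (upd e v (y - 1)) = f (upd e v y).
  by rewrite -dec_upd EG dvdzE dvd1n.
have [h1 p1 [q1 [N1 N10 E1]]] := pwq_limit (oner_neq0 int) hG.
have [h2 p2 [q2 [N2 N20 E2]]] := pwq_limit (isT : -1 != 0 :> int) hG.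
exists (fun e : env V => h1 (upd e v 0) - h2 (upd e v 0)).
  have aff w : affine (fun e : env V => upd e v 0 w) by exact/affine_upd/affine_const.
  exact: pwq_sub (pwq_comp aff p1) (pwq_comp aff p2).
move=> e s us f0; pose b := (\max_(y <- s) `|y|)%N.
have sb y : y \in s -> (`|y| <= b)%N by move=> ys; rewrite /b (big_rem y) //= leq_maxl.
have tele y (n : nat) : G (upd e v (y + n%:Z)) - G (upd e v y) =
    \sum_(i <- iota 0 n) f (upd e v (y + i%:Z + 1)).
  elim: n => [|n IH]; first by rewrite addr0 subrr big_nil.
  have -> : y + n.+1%:Z = y + n%:Z + 1 by lia.
  have Eg := EG e (y + n%:Z + 1); rewrite addrK in Eg.
  by rewrite -[in RHS](addn1 n) iotaD big_cat big_seq1 /= -IH add0n -Eg [RHS]addrC addrA subrK.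
have up (n : nat) : G (upd e v (b%:Z + n%:Z)) = G (upd e v b%:Z).
  apply/eqP; rewrite -subr_eq0 tele big1 // => i _; apply: f0.
  by apply/negP => /sb; lia.
have down (n : nat) : G (upd e v (- b%:Z - 1 - n%:Z)) = G (upd e v (- b%:Z - 1)).
  apply/eqP; rewrite eq_sym -subr_eq0 -{1}[- b%:Z - 1](subrK n%:Z) tele big_seq big1 // => i.
  rewrite mem_iota => /andP[_ lt]; apply: f0.
  by apply/negP => /sb; lia.
have -> : h1 (upd e v 0) = G (upd e v b%:Z).
  have [p Ep] := q1 e; have [t0 Et] := E1 e.
  suff pE : p = (G (upd e v b%:Z))%:P by rewrite Ep pE hornerC.
  apply: (@poly_eventually_eq _ _ 1 N1 (maxn t0 b)) => // t.
  rewrite geq_max => /andP[l0 lb] dv; rewrite -Ep -Et // hornerC mul1r -(up (t - b)%N).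
  by congr (G (upd e v _)); lia.
have -> : h2 (upd e v 0) = G (upd e v (- b%:Z - 1)).
  have [p Ep] := q2 e; have [t0 Et] := E2 e.
  suff pE : p = (G (upd e v (- b%:Z - 1)))%:P by rewrite Ep pE hornerC.
  apply: (@poly_eventually_eq _ _ (-1) N2 (maxn t0 b.+1)) => // t.
  rewrite geq_max => /andP[l0 lb] dv; rewrite -Ep -Et // hornerC mulN1r -(down (t - b.+1)%N).
  by congr (G (upd e v _)); lia.
have {1}-> : b%:Z = - b%:Z - 1 + (b + b).+1%:Z by lia.
rewrite tele -(big_map (fun i : nat => - b%:Z - 1 + i%:Z + 1) xpredT (fun y => f (upd e v y))).
apply: big_uniq_support => //.
  by rewrite map_inj_uniq ?iota_uniq // => i j; lia.
move=> y /sb yb; apply/mapP; exists (absz (y + b%:Z)); last by lia.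
by rewrite mem_iota; lia.
Qed.

End Summation.

(** The support is split into the fibres over the remaining variables. Resetting [v] to [e v] names
    the fibre, and the sum over a fibre is the one-variable sum. *)
Lemma pwq_sum_vars (V : finType) (s : seq V) : uniq s -> forall D f, pwq D f ->
  exists2 g : env V -> rat, pwq (D + size s) g &
  forall (e : env V) (S : seq (env V)), uniq S ->
    (forall x, x \in S -> forall u, u \notin s -> x u = e u) ->
    (forall x : env V, (forall u, u \notin s -> x u = e u) -> x \notin S -> f x = 0) ->
    g e = \sum_(x <- S) f x.
Proof.
elim: s => [_|v s IH /andP[vs us]] D f hf.
  exists f; first by rewrite addn0.
  move=> e S uS ag f0; transitivity (\sum_(x <- [:: e]) f x); first by rewrite big_seq1.
  have Se x : x \in S -> x = e by move=> xS; apply/ffunP => u; exact: ag.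
  have [eS|eS] := boolP (e \in S); last first.
    rewrite big_seq1 f0 // big_seq big1 // => x xS.
    by case/negP: eS; rewrite -(Se x xS).
  apply: perm_big; apply: uniq_perm => // x; rewrite inE.
  by apply/eqP/idP => [->|/Se].
have [g' hg' E'] := pwq_sum_var v hf; have [g hg E] := IH us _ _ hg'.
exists g; first by rewrite /= addnS -addSn.
move=> e S uS ag f0; pose pr (x : env V) := upd x v (e v).
have agp (x : env V) y : (forall u, u \notin s -> x u = e u) ->
    forall u, u \notin v :: s -> upd x v y u = e u.
  by move=> h u; rewrite inE negb_or => /andP[uv us']; rewrite upd_other ?h.
rewrite (E e (undup (map pr S)) (undup_uniq _)).
- have fib (z : env V) : (forall u, u \notin s -> z u = e u) ->
      g' z = \sum_(x <- S | pr x == z) f x.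
    move=> hz; rewrite (E' z [seq (x : env V) v | x <- S & pr x == z]).
    + rewrite big_map big_filter big_seq_cond [RHS]big_seq_cond.
      apply: eq_bigr => x /andP[xS /eqP <-].
      by rewrite /pr upd_upd upd_id.
    + rewrite map_inj_in_uniq ?filter_uniq // => x y.
      rewrite !mem_filter => /andP[/eqP xz _] /andP[/eqP yz _] xy.
      by rewrite -(upd_id x v) -(upd_id y v) -(upd_upd x v (e v)) -(upd_upd y v (e v))
        -/(pr x) -/(pr y) xz yz xy.
    + move=> y yn; apply: f0; first exact: agp.
      apply/negP => zS; case/negP: yn; apply/mapP; exists (upd z v y).
        by rewrite mem_filter zS /pr upd_upd -(hz v vs) upd_id eqxx.
      by rewrite upd_same.
  rewrite big_seq (eq_bigr (fun z => \sum_(x <- S | pr x == z) f x)); last first.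
    move=> z; rewrite mem_undup => /mapP[x xS ->]; apply: fib => u us'.
    rewrite /pr; have [->|uv] := eqVneq u v; first by rewrite upd_same.
    by rewrite upd_other // (ag x xS) // inE negb_or uv.
  rewrite -big_seq (exchange_big_dep xpredT) //=; apply: eq_big_seq => x xS.
  have xp : pr x \in undup (map pr S) by rewrite mem_undup map_f.
  rewrite big_mkcond (bigD1_seq (pr x)) ?undup_uniq //= eqxx.
  by rewrite big1 ?addr0 // => z /negPf; rewrite eq_sym => ->.
- move=> x; rewrite mem_undup => /mapP[z zS ->] u us'.
  rewrite /pr; have [->|uv] := eqVneq u v; first by rewrite upd_same.
  by rewrite upd_other // (ag z zS) // inE negb_or uv.
- move=> x hx xS; rewrite (E' x [::]) ?big_nil // => y _.
  apply: f0; first exact: agp.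
  apply: contra xS => xyS; rewrite mem_undup; apply/mapP; exists (upd x v y) => //.
  by rewrite /pr upd_upd -(hx v vs) upd_id.
Qed.

(** * From decision trees to polyhedra and lattices *)

Section Polyhedra.
Variable k : nat.
Implicit Types (f : env 'I_k -> rat) (x : 'rV[int]_k).

Definition row_env x : env 'I_k := [ffun i => x 0 i].

Definition env_congr (N : nat) (e e' : env 'I_k) : Prop :=
  forall i, (N%:Z %| e i - e' i)%Z.

Lemma env_congr_dvd M N e e' : (M %| N)%N -> env_congr N e e' -> env_congr M e e'.
Proof. by move=> MN h i; apply: dvdz_trans (h i). Qed.

Lemma affine_congr (l : env 'I_k -> int) N e e' : affine l -> env_congr N e e' ->
  (N%:Z %| l e - l e')%Z.
Proof.
move=> [c [a E]] h; rewrite !E opprD addrACA subrr add0r -sumrB.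
by apply: rpred_sum => i _; rewrite -mulrBr dvdz_mull.
Qed.

Lemma poly_fun_mpoly D f : poly_fun D f -> exists2 p : {mpoly rat[k]},
  (msize p <= D.+1)%N & forall e, f e = p.@[fun i => (e i)%:~R].
Proof.
elim=> {D f} [c|i|D f g _ [p sp Ep] _ [q sq Eq]|D D' f g _ [p sp Ep] _ [q sq Eq]
  |D D' f le _ [p sp Ep]|D f g _ [p sp Ep] fg].
- by exists c%:MP => [|e]; [rewrite mmeasureC; case: (_ != _) | rewrite mevalC].
- by exists 'X_i => [|e]; [rewrite msizeX mdeg1 | rewrite mevalXU].
- exists (p + q) => [|e]; last by rewrite mevalD Ep Eq.
  by rewrite (leq_trans (mmeasureD_le _ _ _)) // geq_max sp.
- exists (p * q) => [|e]; last by rewrite mevalM Ep Eq.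
  have [->|p0] := eqVneq p 0; first by rewrite mul0r mmeasure0.
  have [->|q0] := eqVneq q 0; first by rewrite mulr0 mmeasure0.
  by rewrite msizeM //; have := leq_add sp sq; move: (msize p + msize q)%N => a; lia.
- by exists p => //; exact: leq_trans sp _.
- by exists p => // e; rewrite -fg.
Qed.

(** Bounded denominators and periodicity modulo every [M] are proved together, because the step for
    products needs both. Periodicity modulo 1 makes the fractional part constant on cosets. *)
Lemma poly_fun_periodic D f : poly_fun D f ->
  (exists2 d : nat, (0 < d)%N & forall e, exists z : int, d%:R * f e = z%:~R) /\
  (forall M : nat, (0 < M)%N -> exists2 N : nat, (0 < N)%N & forall e e', env_congr N e e' ->
     exists z : int, f e - f e' = (M%:Z * z)%:~R).
Proof.
elim=> {D f} [c|i|D f g _ [[d d0 df] pf] _ [[d' d0' dg] pg]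
  |D D' f g _ [[d d0 df] pf] _ [[d' d0' dg] pg]|//|D f g _ [[d d0 df] pf] fg].
- split; last by move=> M _; exists 1%N => // e e' _; exists 0; rewrite subrr mulr0.
  exists `|denq c|%N; first by rewrite absz_gt0 denq_neq0.
  by move=> e; exists (numq c); rewrite numqE mulrC pmulrn absz_denq.
- split; first by exists 1%N => // e; exists (e i); rewrite mul1r.
  move=> M M0; exists M => // e e' /(_ i) /dvdzP[z E].
  by exists z; rewrite -rmorphB E mulrC.
- split.
    exists (d * d')%N; first by rewrite muln_gt0 d0.
    move=> e; have [z zE] := df e; have [z' zE'] := dg e.
    exists (d'%:Z * z + d%:Z * z'); rewrite natrM rmorphD !rmorphM /= -zE -zE' -!pmulrn.
    by ring.
  move=> M M0; have [N N0 hN] := pf M M0; have [N' N0' hN'] := pg M M0.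
  exists (N * N')%N => [|e e' h]; first by rewrite muln_gt0 N0.
  have [z zE] := hN _ _ (env_congr_dvd (dvdn_mulr _ (dvdnn _)) h).
  have [z' zE'] := hN' _ _ (env_congr_dvd (dvdn_mull _ (dvdnn _)) h).
  by exists (z + z'); rewrite mulrDr rmorphD /= -zE -zE'; ring.
- split.
    exists (d * d')%N; first by rewrite muln_gt0 d0.
    move=> e; have [z zE] := df e; have [z' zE'] := dg e.
    by exists (z * z'); rewrite natrM rmorphM /= -zE -zE'; ring.
  move=> M M0.
  (* In [f e * (g e - g e') + g e' * (f e - f e')] each difference must absorb the denominator of
     the factor next to it. *)
  have [|N N0 hN] := pf (d' * M)%N; first by rewrite muln_gt0 d0'.
  have [|N' N0' hN'] := pg (d * M)%N; first by rewrite muln_gt0 d0.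
  exists (N * N')%N => [|e e' h]; first by rewrite muln_gt0 N0.
  have [z zE] := hN _ _ (env_congr_dvd (dvdn_mulr _ (dvdnn _)) h).
  have [z' zE'] := hN' _ _ (env_congr_dvd (dvdn_mull _ (dvdnn _)) h).
  have [w wE] := df e; have [w' wE'] := dg e'.
  exists (w * z' + w' * z); rewrite (_ : _ - _ = f e * (g e - g e') + g e' * (f e - f e'));
    last by ring.
  rewrite zE zE' !PoszM !rmorphM rmorphD !rmorphM /= -wE -wE' -!pmulrn; ring.
- split; first by exists d => // e; rewrite -fg.
  move=> M M0; have [N N0 h] := pf M M0; exists N => // e e' /h[z E].
  by exists z; rewrite -!fg.
Qed.

Lemma in_polyhedron_cons c P x : in_polyhedron (c :: P) x <->
  \sum_(i < k) c.1 0 i * (x 0 i)%:~R <= c.2 /\ in_polyhedron P x.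
Proof.
split=> [h|[h1 h2] b].
  by split=> [|b bP]; apply: h; rewrite inE ?eqxx // bP orbT.
by rewrite inE => /orP[/eqP->|/h2].
Qed.

Lemma in_polyhedron_cat P P' x :
  in_polyhedron (P ++ P') x <-> in_polyhedron P x /\ in_polyhedron P' x.
Proof.
split=> [h|[h1 h2] b]; last by rewrite mem_cat => /orP[/h1|/h2].
by split=> b bP; apply: h; rewrite mem_cat bP ?orbT.
Qed.

Lemma affine_halfspace (l : env 'I_k -> int) : affine l ->
  exists c : 'rV[rat]_k * rat, forall x,
    (\sum_(i < k) c.1 0 i * (x 0 i)%:~R <= c.2) = (0 <= l (row_env x)).
Proof.
move=> [c [a E]]; exists (\row_i - (a i)%:~R, c%:~R) => x /=.
rewrite E -subr_ge0 -(ler_int rat) rmorphD rmorph_sum /=; congr (0 <= _ + _).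
rewrite -sumrN; apply: eq_bigr => i _.
by rewrite mxE rmorphM mulNr opprK ffunE.
Qed.

Lemma pwq_floor_quasipoly D f : pwq D f ->
  piecewise_quasipoly D (fun x => Num.floor (f (row_env x))).
Proof.
move=> hf.
have [N N0 [Ps [cov H]]] : exists2 N : nat, (0 < N)%N & exists Ps : seq (seq ('rV[rat]_k * rat)),
    (forall x, exists2 P, P \in Ps & in_polyhedron P x) /\
    (forall P, P \in Ps -> forall x0, exists2 p : {mpoly rat[k]}, (msize p <= D.+1)%N &
       forall x, in_polyhedron P x -> env_congr N (row_env x) (row_env x0) ->
         (Num.floor (f (row_env x)))%:~R = p.@[fun i => (x 0 i)%:~R]).
  elim: hf => {f} [f hf|P f g h hP _ [N N0 [Ps [covf Hf]]] _ [N' N0' [Ps' [covg Hg]]] hE].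
    have [p sp Ep] := poly_fun_mpoly hf.
    have [_ /(_ 1%N isT)[N N0 hN]] := poly_fun_periodic hf.
    exists N => //; exists [:: [::]]; split=> [x|P _ x0]; first by exists [::].
    (* The fractional part at [x0], which is shared by the whole coset; subtracting it from the
       polynomial gives the floor. *)
    pose c := f (row_env x0) - (Num.floor (f (row_env x0)))%:~R.
    exists (p - c%:MP) => [|x _ xx0].
      rewrite (leq_trans (mmeasureD_le _ _ _)) // geq_max sp mmeasureN mmeasureC.
      by case: (_ != _).
    have [z zE] := hN _ _ xx0; rewrite mul1r in zE.
    rewrite mevalB mevalC -(@meval_eq _ _ (fun i => (row_env x i)%:~R)); last first.
      by move=> i; rewrite ffunE.
    rewrite -Ep -(subrK (f (row_env x0)) (f (row_env x))) zE floorDzr ?intr_int //.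
    by rewrite rmorphD /= /c intrKfloor; ring.
  case: hP => [l hl PE|m l m0 hl PE].
    have [c Ec] := affine_halfspace hl.
    (* Over the integers the complement of a closed half-space is again a closed half-space,
       [0 <= - l - 1]. *)
    have [c' Ec'] := affine_halfspace (affine_sub (affine_opp hl) (affine_const _ 1)).
    exists (N * N')%N; first by rewrite muln_gt0 N0.
    exists (map (cons c) Ps ++ map (cons c') Ps'); split=> [x|Q].
      have [l0|l0] := boolP (0 <= l (row_env x)).
        have [Q QPs xQ] := covf x; exists (c :: Q); last by apply/in_polyhedron_cons; rewrite Ec.
        by rewrite mem_cat map_f.
      have [Q QPs xQ] := covg x; exists (c' :: Q).
        by rewrite mem_cat map_f // orbT.
      by apply/in_polyhedron_cons; rewrite Ec'; split=> //; move: l0; lia.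
    rewrite mem_cat => /orP[]/mapP[Q' QPs ->] x0.
      have [p sp Ep] := Hf _ QPs x0; exists p => // x /in_polyhedron_cons[].
      rewrite Ec => l0 xQ xx0; rewrite hE PE l0 Ep //.
      exact: env_congr_dvd (dvdn_mulr _ (dvdnn _)) xx0.
    have [p sp Ep] := Hg _ QPs x0; exists p => // x /in_polyhedron_cons[].
    rewrite Ec' => l0 xQ xx0; rewrite hE PE ifN ?Ep //; last by move: l0; lia.
    exact: env_congr_dvd (dvdn_mull _ (dvdnn _)) xx0.
  exists (m * (N * N'))%N; first by rewrite !muln_gt0 N0 m0.
  (* A divisibility test is decided by the coset and not by the polyhedron, so each new piece must
     lie in a piece of either branch. *)
  exists [seq Q ++ Q' | Q <- Ps, Q' <- Ps']; split=> [x|_ /allpairsP[[Q Q'] /= [hQ hQ' ->]] x0].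
    have [Q QPs xQ] := covf x; have [Q' QPs' xQ'] := covg x.
    by exists (Q ++ Q'); [exact: allpairs_f | apply/in_polyhedron_cat].
  have dm x : env_congr (m * (N * N')) (row_env x) (row_env x0) ->
      (m%:Z %| l (row_env x))%Z = (m%:Z %| l (row_env x0))%Z.
    move=> /(env_congr_dvd (dvdn_mulr _ (dvdnn _))) /(affine_congr hl) dv.
    by rewrite -(subrK (l (row_env x0)) (l (row_env x))) addrC dvdzDr.
  have dN : (N %| m * (N * N'))%N by rewrite mulnCA dvdn_mulr.
  have dN' : (N' %| m * (N * N'))%N by rewrite mulnA dvdn_mull.
  have [p sp Ep] := Hf _ hQ x0; have [q sq Eq] := Hg _ hQ' x0.
  exists (if (m%:Z %| l (row_env x0))%Z then p else q); first by case: ifP.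
  move=> x /in_polyhedron_cat[xQ xQ'] xx0; rewrite hE PE dm //; case: ifP => _.
    by apply: Ep => //; exact: env_congr_dvd xx0.
  by apply: Eq => //; exact: env_congr_dvd xx0.
exists Ps; split=> // P PPs.
exists (fun x : 'rV[int]_k => forall i : 'I_k, (N%:Z %| row_env x i)%Z); split; last first.
  move=> x0; have [p sp Ep] := H P PPs x0; exists p; split=> // x xP xx0.
  by apply: Ep => // i; have := xx0 i; rewrite !ffunE !mxE.
split; first by move=> i; rewrite ffunE mxE dvdz0.
split.
  by move=> x y hx hy i; have := rpredB (hx i) (hy i); rewrite !ffunE !mxE.
pose rep (w : {ffun 'I_k -> 'I_N}) : 'rV[int]_k := \row_i (w i : nat)%:Z.
exists (codom rep) => x.
have Nn : N%:Z != 0 by rewrite eqz_nat -lt0n.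
have lt i : (`|(x ord0 i %% N%:Z)%Z| < N)%N.
  by rewrite -ltz_nat gez0_abs ?modz_ge0 ?ltz_pmod ?ltz_nat.
exists (rep [ffun i => Ordinal (lt i)]); first exact: codom_f.
move=> i; rewrite ffunE !mxE ffunE /= gez0_abs ?modz_ge0 //.
by rewrite {1}(divz_eq (x ord0 i) N%:Z) addrK dvdz_mull.
Qed.

End Polyhedra.

(** * Krull dimension *)

Section CoefSum.
Variables (n : nat) (R : nzRingType).
Implicit Types (p : pred 'X_{1..n}) (f g : {mpoly R[n]}).

(** The coefficient that remains when all monomials satisfying [p] are identified. Annihilation and
    the toric kernels below are both vanishing conditions on such sums. *)
Definition coefsum p f : R := \sum_(m <- msupp f | p m) f@_m.

Lemma coefsumE p f i : (msize f <= i)%N ->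
  coefsum p f = \sum_(m : 'X_{1..n < i} | p m) f@_m.
Proof.
move=> le; pose I : subFinType _ := 'X_{1..n < i}.
rewrite /coefsum big_mkcond (big_mksub I) ?msupp_uniq //=; last first.
  by move=> x /msize_mdeg_lt /leq_trans; apply.
rewrite big_mkcond [RHS]big_mkcond; apply: eq_bigr => j _.
by case: ifPn => // /memN_msupp_eq0 ->; case: ifP.
Qed.

Lemma coefsumD p f g : coefsum p (f + g) = coefsum p f + coefsum p g.
Proof.
pose i := maxn (msize f) (msize g).
rewrite !(@coefsumE p _ i) ?leq_maxl ?leq_maxr ?(leq_trans (mmeasureD_le _ _ _)) //.
by rewrite -big_split; apply: eq_bigr => m _; rewrite mcoeffD.
Qed.

Lemma coefsumZ p c f : coefsum p (c *: f) = c * coefsum p f.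
Proof.
rewrite !(@coefsumE p _ (msize f)) ?msizeZ_le // mulr_sumr.
by apply: eq_bigr => m _; rewrite mcoeffZ.
Qed.

Lemma coefsumX p m : coefsum p 'X_[R, m] = (p m)%:R.
Proof.
rewrite /coefsum msuppX big_mkcond big_seq1 mcoeffX eqxx.
by case: (p m).
Qed.

Lemma coefsum_sum (I : Type) (r : seq I) (Q : pred I) p (G : I -> {mpoly R[n]}) :
  coefsum p (\sum_(i <- r | Q i) G i) = \sum_(i <- r | Q i) coefsum p (G i).
Proof.
apply: (big_morph (coefsum p) (coefsumD p)).
by rewrite /coefsum msupp0 big_nil.
Qed.

End CoefSum.

Section Semigroup.
Variables (d r : nat) (gens : 'I_r -> 'rV[int]_d).

Lemma in_sg0 : in_sg gens 0.
Proof. by exists (fun _ => 0%N); rewrite big1. Qed.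

Lemma in_sgD p q : in_sg gens p -> in_sg gens q -> in_sg gens (p + q).
Proof.
move=> [a ->] [b ->]; exists (fun i => (a i + b i)%N).
by rewrite -big_split; apply: eq_bigr => i _; rewrite mulrnDr.
Qed.

Lemma in_sg_gen i : in_sg gens (gens i).
Proof.
exists (fun j => (j == i)%N); rewrite (bigD1 i) //= eqxx mulr1n big1 ?addr0 // => j /negPf ->.
by rewrite mulr0n.
Qed.

Lemma in_sg_sum (I : Type) (s : seq I) (P : pred I) (f : I -> 'rV[int]_d) :
  (forall i, P i -> in_sg gens (f i)) -> in_sg gens (\sum_(i <- s | P i) f i).
Proof. by move=> h; apply: big_ind h => //; [exact: in_sg0 | exact: in_sgD]. Qed.

Lemma in_sgMn p k : in_sg gens p -> in_sg gens (p *+ k).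
Proof.
by move=> [c ->]; exists (fun i => (c i * k)%N); rewrite -sumrMnl; apply: eq_bigr => i _;
  rewrite mulrnA.
Qed.

Lemma in_sg_mexp m : in_sg gens (mexp gens m).
Proof. by exists m. Qed.

End Semigroup.

Section PrimeIdeals.
Variables (F : fieldType) (r : nat) (P : {mpoly F[r]} -> Prop).
Hypothesis pP : prime_ideal P.

Lemma prime_ideal_sum (I : eqType) (s : seq I) (Q : pred I) (f : I -> {mpoly F[r]}) :
  (forall i, i \in s -> Q i -> P (f i)) -> P (\sum_(i <- s | Q i) f i).
Proof.
case: pP => p0 [pD _] h; rewrite big_seq_cond; apply: big_ind => // i /andP[]; exact: h.
Qed.

Lemma prime_idealZ c f : P f -> P (c *: f).
Proof. by case: pP => _ [_ [pM _]] h; rewrite -mul_mpolyC; exact: pM. Qed.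

Lemma prime_idealB f g : P f -> P g -> P (f - g).
Proof.
move=> hf /(prime_idealZ (-1)); rewrite scaleN1r; case: pP => _ [pD _]; exact: pD.
Qed.

Lemma prime_idealX f k : P (f ^+ k) -> P f.
Proof.
case: pP => _ [_ [_ [p1 pp]]]; elim: k => [|k IH]; first by rewrite expr0 => /p1.
by rewrite exprS => /pp[].
Qed.

Lemma prime_ideal_prod (I : Type) (s : seq I) (f : I -> {mpoly F[r]}) :
  P (\prod_(i <- s) f i) -> exists i, P (f i).
Proof.
case: pP => _ [_ [_ [p1 pp]]]; elim: s => [|i s IH]; first by rewrite big_nil => /p1.
by rewrite big_cons => /pp[h|/IH//]; exists i.
Qed.

End PrimeIdeals.

Section Krull.
Variables (F : fieldType) (d r : nat) (gens : 'I_r -> 'rV[int]_d) (M : qmod F d).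
Implicit Types (T : {set 'I_r}) (m : 'X_{1..r}) (f : {mpoly F[r]}).

Definition sum_gens (T : {set 'I_r}) : 'rV[int]_d := \sum_(i in T) gens i.

(* No power of the product of the variables indexed by [T] annihilates [M]. *)
Definition unbounded (T : {set 'I_r}) : Prop :=
  forall k : nat, exists q, qact M q (q + sum_gens T *+ k) <> 0.

(** Rows outside [T] are zeroed and not deleted, so that the shape does not depend on [T]. *)
Definition gens_mx (T : {set 'I_r}) : 'M[rat]_(r, d) :=
  \matrix_(i, j) if i \in T then (gens i 0 j)%:~R else 0.

Definition gens_rank (T : {set 'I_r}) : nat := \rank (gens_mx T).

Definition supported (T : {set 'I_r}) (m : 'X_{1..r}) : bool :=
  [forall i, (i \notin T) ==> (m i == 0%N)].

Lemma supportedP T m : reflect (forall i, i \notin T -> m i = 0%N) (supported T m).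
Proof.
apply: (iffP forallP) => h i; first by move=> iT; have := h i; rewrite iT => /eqP.
by apply/implyP => /h/eqP.
Qed.

Lemma ann_PE f : ann_P gens M f <-> forall q q', in_sg gens (q' - q) ->
  coefsum (fun m => q + mexp gens m == q') f *: qact M q q' = 0.
Proof. by []. Qed.

Lemma ann_P_binomial m m' : mexp gens m = mexp gens m' ->
  ann_P gens M ('X_[m] - 'X_[m']).
Proof.
move=> E; apply/ann_PE => q q' _.
by rewrite -scaleN1r coefsumD coefsumZ !coefsumX E mulN1r subrr scale0r.
Qed.

Lemma mexp_gens_mx T m : supported T m ->
  map_mx intr (mexp gens m) = (\row_i (m i)%:R) *m gens_mx T :> 'rV[rat]_d.
Proof.
move=> /supportedP h; apply/rowP => j; rewrite !mxE /mexp summxE rmorph_sum.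
apply: eq_bigr => i _; rewrite !mxE mulmxnE rmorphMn /= mulr_natl.
by case: ifP => // /negbT/h ->; rewrite !mulr0n.
Qed.

(* Coordinates of Z^d that determine the elements of the span of the
   generators indexed by [T]. *)
Definition coords (T : {set 'I_r}) : 'I_(gens_rank T) -> 'I_d :=
  fun t => maxrankfun (gens_mx T)^T (cast_ord (esym (mxrank_tr (gens_mx T))) t).

Lemma coords_inj T m m' : supported T m -> supported T m' ->
  (forall t : 'I_(gens_rank T), mexp gens m 0 (coords t) = mexp gens m' 0 (coords t)) ->
  mexp gens m = mexp gens m'.
Proof.
move=> sm sm' h; suff E : map_mx intr (mexp gens m) = map_mx intr (mexp gens m') :> 'rV[rat]_d.
  by apply/rowP => j; have /rowP/(_ j) := E; rewrite !mxE => /intr_inj.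
apply: trmx_inj; rewrite (mexp_gens_mx sm) (mexp_gens_mx sm') !trmx_mul.
have /submxP[X XE] : ((gens_mx T)^T <= rowsub (maxrankfun (gens_mx T)^T) (gens_mx T)^T)%MS.
  by rewrite eq_maxrowsub.
rewrite XE -!mulmxA; congr (_ *m _).
apply/matrixP => t z; rewrite ord1 {z}.
have := h (cast_ord (mxrank_tr _) t); rewrite /coords.
have -> : cast_ord (esym (mxrank_tr (gens_mx T))) (cast_ord (mxrank_tr (gens_mx T)) t) = t.
  exact: val_inj.
set j := maxrankfun _ t => hj.
have val m0 : supported T m0 -> (rowsub (maxrankfun (gens_mx T)^T) (gens_mx T)^T *m
    (\row_i (m0 i)%:R)^T) t 0 = (mexp gens m0 0 j)%:~R.
  move=> s0; have /rowP/(_ j) := mexp_gens_mx s0; rewrite mxE => ->.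
  by rewrite !mxE; apply: eq_bigr => i _; rewrite !mxE mulrC.
by rewrite !val // hj.
Qed.

End Krull.

(** * Upper bound for chains of primes *)

Section KrullUpper.
Variables (F : fieldType) (d r : nat) (gens : 'I_r -> 'rV[int]_d) (M : qmod F d).
Implicit Types (T : {set 'I_r}) (m : 'X_{1..r}) (f : {mpoly F[r]}).

(** [T] consists of the variables outside [P]. As [P] is prime, no power of their product lies in
    [P], hence none annihilates [M]. *)
Lemma prime_unbounded P : prime_ideal P -> (forall f, ann_P gens M f -> P f) ->
  exists2 T, unbounded gens M T & forall i, i \notin T -> P 'X_i.
Proof.
move=> pP hP.
have ex i : exists b : bool, b <-> ~ P 'X_i.
  by case: (classic (P 'X_i)) => h; [exists false|exists true]; split.
have [b Eb] := fin_all_exists ex.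
exists [set i | b i] => [|i]; last first.
  by rewrite inE => /negP h; apply: NNPP => /Eb.
set T := [set i | b i] => k; apply: NNPP => nex.
pose m := [multinom (if i \in T then k else 0%N) | i < r].
have mE : mexp gens m = sum_gens gens T *+ k.
  rewrite /mexp /sum_gens -sumrMnl [RHS]big_mkcond; apply: eq_bigr => i _.
  by rewrite mnmE; case: ifP => // _; rewrite mulr0n.
have : P 'X_[m].
  apply: hP; apply/ann_PE => q q' _; rewrite coefsumX mE.
  case: eqP => [<-|_]; last by rewrite scale0r.
  rewrite scale1r; apply: NNPP => h; apply: nex; by exists q.
rewrite mpolyXE_id => /(prime_ideal_prod pP)[i].
rewrite mnmE; case: ifP => [iT /(prime_idealX pP)|_].
  by move: iT; rewrite inE => /Eb.
by rewrite expr0; case: pP => _ [_ [_ [p1 _]]].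
Qed.

Section Dependence.
Variables (P : {mpoly F[r]} -> Prop) (T : {set 'I_r}).
Hypotheses (pP : prime_ideal P) (annP : forall f, ann_P gens M f -> P f).
Hypothesis outP : forall i, i \notin T -> P 'X_i.

Lemma monomial_outside m : ~~ supported T m -> P 'X_[m].
Proof.
case/forallPn => i; rewrite negb_imply => /andP[iT mi].
rewrite mpolyXE_id (bigD1 i) //= mulrC; case: pP => _ [_ [pM _]]; apply: (pM).
by rewrite -(prednK (n := m i)) ?lt0n // exprSr; apply: pM; exact: outP.
Qed.

(** Modulo [P] the monomials not supported in [T] vanish and those with equal key coincide. So [f]
    reduces to one representative per key, with the coefficient sums as coefficients. *)
Lemma coefsum_prime (K : finType) (key : 'X_{1..r} -> K) f :
  (forall m m', m \in msupp f -> m' \in msupp f -> supported T m -> supported T m' ->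
     key m = key m' -> mexp gens m = mexp gens m') ->
  (forall x, coefsum (fun m => supported T m && (key m == x)) f = 0) -> P f.
Proof.
move=> keyP f0.
pose rep x := head 0%MM [seq m <- msupp f | supported T m && (key m == x)].
have repP m : m \in msupp f -> supported T m ->
    [/\ rep (key m) \in msupp f, supported T (rep (key m)) & key (rep (key m)) = key m].
  move=> mf sm; rewrite /rep.
  have : m \in [seq m' <- msupp f | supported T m' && (key m' == key m)].
    by rewrite mem_filter sm eqxx.
  case E : [seq _ <- _ | _] => [//|m0 s] _ /=.
  have : m0 \in m0 :: s by rewrite inE eqxx.
  by rewrite -E mem_filter => /andP[/andP[-> /eqP ->] ->].
have -> : f = \sum_(m <- msupp f | supported T m) f@_m *: ('X_[m] - 'X_[rep (key m)]) +
              \sum_(m <- msupp f | ~~ supported T m) f@_m *: 'X_[m].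
  rewrite {1}[f]mpolyE (bigID (supported T)) /=; congr (_ + _).
  under [RHS]eq_bigr do rewrite scalerBr.
  suff rep0 : \sum_(m <- msupp f | supported T m) f@_m *: 'X_[rep (key m)] = 0 :> {mpoly F[r]}.
    by rewrite sumrB rep0 subr0.
  rewrite (partition_big key xpredT) //= big1 // => x _.
  under eq_bigr => m /andP[_ /eqP ->] do [].
  by rewrite -scaler_suml (f0 x : \sum_(_ <- _ | _) _ = 0) scale0r.
have [_ [pD _]] := pP; apply: pD.
  apply: prime_ideal_sum => // m mf sm; apply: prime_idealZ => //.
  have [rf rs rk] := repP m mf sm.
  by apply: annP; apply: ann_P_binomial; exact: keyP.
by apply: prime_ideal_sum => // m mf sm; apply: prime_idealZ => //; exact: monomial_outside.
Qed.

(** The coefficient sums map the span of the [G a] to a space of dimension [#|K|]; with more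
    polynomials than keys there is a nontrivial kernel vector. *)
Lemma prime_dependence (K A : finType) (key : 'X_{1..r} -> K) (s : nat) (G : A -> {mpoly F[r]}) :
  (forall m m', (mdeg m < s)%N -> (mdeg m' < s)%N -> supported T m -> supported T m' ->
     key m = key m' -> mexp gens m = mexp gens m') ->
  (forall a, (msize (G a) <= s)%N) -> (#|K| < #|A|)%N ->
  exists2 c : A -> F, (exists a, c a != 0) & P (\sum_a c a *: G a).
Proof.
move=> keyP sG KA.
pose W : 'M[F]_(#|A|, #|K|) := \matrix_(a, x)
  coefsum (fun m => supported T m && (key m == enum_val x)) (G (enum_val a)).
have /rowV0Pn[u uW u0] : kermx W != 0.
  by rewrite kermx_eq0 /row_free neq_ltn (leq_ltn_trans (rank_leq_col W)).
have {}uW : u *m W = 0 by apply/sub_kermxP.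
exists (fun a => u 0 (enum_rank a)).
  by have [i ui] := rV0Pn u u0; exists (enum_val i); rewrite enum_valK.
have sumE p : coefsum p (\sum_a u 0 (enum_rank a) *: G a) =
    \sum_a u 0 (enum_rank a) * coefsum p (G a).
  by rewrite coefsum_sum; apply: eq_bigr => a _; rewrite coefsumZ.
apply: (@coefsum_prime _ key) => [m m' mf mf'|x].
  have szs : (msize (\sum_a u 0 (enum_rank a) *: G a) <= s)%N.
    apply: (big_ind (fun f => (msize f <= s)%N)) => [|f g hf hg|a _].
    - by rewrite mmeasure0.
    - by rewrite (leq_trans (mmeasureD_le _ _ _)) // geq_max hf.
    - exact: leq_trans (msizeZ_le _ _) (sG a).
  by apply: keyP; apply: leq_trans (msize_mdeg_lt _) szs.
rewrite sumE; have /rowP/(_ (enum_rank x)) := uW; rewrite !mxE => E; rewrite -[RHS]E.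
rewrite [RHS](reindex_onto (@enum_rank A) (@enum_val A _)) /=; last by move=> a _; rewrite enum_valK.
rewrite [RHS](eq_bigl xpredT); last by move=> a; rewrite enum_rankK eqxx.
by apply: eq_bigr => a _; rewrite !mxE !enum_rankK.
Qed.

End Dependence.

Section Independence.
Variables (l s : nat) (C : nat -> {mpoly F[r]} -> Prop) (Fs : 'I_l -> {mpoly F[r]}).
Hypotheses (primeC : forall j, (j <= l)%N -> prime_ideal (C j))
  (incC : forall j f, (j < l)%N -> C j f -> C j.+1 f)
  (FsC : forall j : 'I_l, C j.+1 (Fs j)) (FsNC : forall j : 'I_l, ~ C j (Fs j)).
Implicit Type a : {ffun 'I_l -> 'I_s.+1}.

Definition tail_prod (j : nat) a : {mpoly F[r]} := \prod_(t < l | (j <= t)%N) Fs t ^+ a t.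

(* Elements [Fs j] of [C j.+1 \ C j] are algebraically independent modulo
   [C 0]: divide a relation by the highest power of [Fs 0] and reduce it
   modulo [C 1]. *)
Lemma chain_independent j (S : {set {ffun 'I_l -> 'I_s.+1}}) (c : {ffun 'I_l -> 'I_s.+1} -> F) :
  (j <= l)%N -> S != set0 -> {in S, forall a, c a != 0} ->
  {in S &, forall a a' (t : 'I_l), (t < j)%N -> a t = a' t} ->
  ~ C j (\sum_(a in S) c a *: tail_prod j a).
Proof.
move=> jl; have [n] := ubnP (l - j); elim: n j S jl => // n IH j S jl lt S0 cS agS.
have [_ [_ [pM [p1 pp]]]] := primeC jl.
have [lj|lj] := leqP l j.
  have je : j = l by apply/eqP; rewrite eqn_leq jl.
  have /set0Pn[a aS] := S0; have SE : S = [set a].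
    apply/setP => a'; rewrite inE; apply/idP/eqP => [aS'|->//].
    by apply/ffunP => t; apply: agS => //; rewrite je.
  rewrite SE big_set1 /tail_prod big1 => [|t /(leq_trans lj)]; last by rewrite leqNgt ltn_ord.
  move=> /(prime_idealZ (primeC jl) (c a)^-1).
  by rewrite scalerA mulVf ?cS // scale1r.
pose oj := Ordinal lj.
have /set0Pn[a0 a0S] := S0.
have [a1 a1S min] := arg_minnP (fun a => nat_of_ord (a oj)) a0S.
have {}a1S : a1 \in S by [].
pose u := nat_of_ord (a1 oj).
have tailE a : tail_prod j a = Fs oj ^+ a oj * tail_prod j.+1 a.
  rewrite /tail_prod (bigD1 oj) //=; congr (_ * _).
  by apply: eq_bigl => t; rewrite ltn_neqAle andbC eq_sym.
have -> : \sum_(a in S) c a *: tail_prod j a =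
    Fs oj ^+ u * \sum_(a in S) c a *: (Fs oj ^+ (a oj - u) * tail_prod j.+1 a).
  rewrite mulr_sumr; apply: eq_bigr => a aS.
  by rewrite tailE -scalerAr mulrA -exprD subnKC // min.
move=> /pp[/(prime_idealX (primeC jl))|]; first exact: (FsNC (j := oj)).
move=> /(incC lj); rewrite (bigID (fun a => a oj == a1 oj)) /=.
set A := (X in X + _); set B := (X in _ + X) => hAB.
have hB : C j.+1 B.
  apply: (prime_ideal_sum (primeC lj)) => a _ /andP[aS ne].
  apply: prime_idealZ; first exact: primeC.
  have [_ [_ [pM' _]]] := primeC lj.
  rewrite mulrC; apply: (pM'); rewrite -(prednK (n := (a oj - u)%N)).
    rewrite exprSr; apply: pM'; exact: (FsC oj).
  by rewrite subn_gt0 ltn_neqAle min // andbT eq_sym.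
have hA : C j.+1 A by have := prime_idealB (primeC lj) hAB hB; rewrite addrK.
have := IH j.+1 [set a in S | a oj == a1 oj] lj; apply.
- by move: lt; lia.
- by apply/set0Pn; exists a1; rewrite inE a1S eqxx.
- by move=> a; rewrite inE => /andP[/cS].
- move=> a a' ; rewrite !inE => /andP[aS /eqP ea] /andP[aS' /eqP ea'] t.
  rewrite ltnS leq_eqVlt => /orP[/eqP tj|]; last exact: agS.
  by have -> : t = oj; [exact: val_inj | rewrite ea ea'].
- rewrite (_ : \sum_(_ in _) _ = A) // /A; apply: eq_big => [a|a].
    by rewrite inE.
  by rewrite inE => /andP[_ /eqP ->]; rewrite subnn expr0 mul1r.
Qed.

End Independence.

Lemma msizeM_addn (f g : {mpoly F[r]}) : (msize (f * g) <= msize f + msize g)%N.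
Proof.
have [->|f0] := eqVneq f 0; first by rewrite mul0r mmeasure0.
have [->|g0] := eqVneq g 0; first by rewrite mulr0 mmeasure0.
by rewrite msizeM // leq_pred.
Qed.

Lemma msize_prod_le (l s D : nat) (Fs : 'I_l -> {mpoly F[r]}) (a : {ffun 'I_l -> 'I_s.+1}) :
  (forall j, (msize (Fs j) <= D)%N) ->
  (msize (\prod_(t < l) Fs t ^+ a t) <= l * (s * D).+1 + 1)%N.
Proof.
move=> hD; have hX f k : (msize f <= D)%N -> (msize (f ^+ k) <= (k * D).+1)%N.
  move=> fD; elim: k => [|k IH]; first by rewrite expr0 msize1.
  by rewrite exprS (leq_trans (msizeM_addn _ _)) // mulSn -addnS leq_add.
rewrite -[X in (X * _)%N]card_ord -sum_nat_const.
apply: (big_ind2 (fun f k => (msize f <= k + 1)%N)) => [|f k f' k' hf hf'|t _].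
- by rewrite msize1.
- have [->|f0] := eqVneq f 0; first by rewrite mul0r mmeasure0.
  have [->|f0'] := eqVneq f' 0; first by rewrite mulr0 mmeasure0.
  rewrite msizeM //; have := leq_add hf hf'; move: (msize f + msize f')%N => z; lia.
- rewrite (leq_trans (hX _ _ (hD t))) // addn1 ltnS.
  by apply/leqW; rewrite leq_mul2r -ltnS ltn_ord orbT.
Qed.

(** If [l] exceeded the rank [rho], the [(s + 1) ^ l] products of the [Fs] with exponents at most
    [s] would outnumber the degrees available modulo the binomials. The latter grow only like
    [s ^ rho], so a relation would contradict independence along the chain. *)
Lemma krull_upper l : prime_chain gens M l ->
  exists2 T, unbounded gens M T & (l <= gens_rank gens T)%N.
Proof.
move=> [C [primeC [annC chainC]]].
have [T unbT outT] := prime_unbounded (primeC 0%N isT) annC.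
exists T => //; set rho := gens_rank gens T; rewrite leqNgt; apply/negP => rl.
have [Fs FsC FsNC] : exists2 Fs : 'I_l -> {mpoly F[r]}, (forall j : 'I_l, C j.+1 (Fs j)) &
    forall j : 'I_l, ~ C j (Fs j).
  apply: (fin_all_exists2 (P := fun j : 'I_l => C j.+1) (Q := fun (j : 'I_l) f => ~ C j f)).
  move=> j; have [_ [f [h1 h2]]] := chainC j (ltn_ord j).
  by exists f.
pose D := (\max_(j < l) msize (Fs j))%N.
have hD j : (msize (Fs j) <= D)%N by exact: (leq_bigmax j).
pose g := (\sum_i \sum_j `|gens i (ord0 : 'I_1) j|)%N.
(* Chosen so that [2 * g * B + 1 <= c0 * (s + 1)]. With [s = c0 ^ rho] the number of keys is then at
   most [s * (s + 1) ^ rho], which is below [(s + 1) ^ rho.+1]. *)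
pose c0 := (2 * g * (l * D.+1 + 1)).+1.
pose s := (c0 ^ rho)%N.
pose B := (l * (s * D).+1 + 1)%N.
have ent m j : (mdeg m < B)%N -> (`|mexp gens m ord0 j| <= g * B)%N.
  move=> mB; apply: (@leq_trans (g * mdeg m)); last by rewrite leq_mul2l (ltnW mB) orbT.
  rewrite /mexp summxE mdegE.
  apply: (@leq_trans (\sum_i `|gens i ord0 j| * m i)%N).
    elim/big_ind2: _ => [//|x1 x2 y1 y2 h1 h2|i _].
      by lia.
    by rewrite mulmxnE -mulr_natr abszM natz.
  rewrite big_distrr leq_sum //= => i _; rewrite leq_mul2r; apply/orP; right.
  by rewrite /g (bigD1 i) //= (bigD1 j) //= -addnA leq_addr.
pose K := {ffun 'I_rho -> 'I_(2 * g * B).+1}.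
(* Each selected coordinate has absolute value at most [g * B]; the shift moves it into the range
   from 0 to [2 * g * B]. *)
pose key m : K :=
  [ffun t : 'I_(gens_rank gens T) => inord (absz (mexp gens m ord0 (coords t) + (g * B)%N%:Z))].
have keyP m m' : (mdeg m < B)%N -> (mdeg m' < B)%N -> supported T m -> supported T m' ->
    key m = key m' -> mexp gens m = mexp gens m'.
  move=> mB mB' sm sm' /ffunP E; apply: (coords_inj sm sm') => t.
  have := congr1 val (E t); rewrite !ffunE /=.
  have := ent _ (coords t) mB; have := ent _ (coords t) mB'.
  move: (mexp gens m ord0 _) (mexp gens m' ord0 _) => x y hy hx.
  rewrite !inordK; lia.
have cardKA : (#|K| < #|{ffun 'I_l -> 'I_s.+1}|)%N.
  have hB : (B <= (l * D.+1 + 1) * s.+1)%N.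
    by rewrite /B mulnDl mul1n leq_add // -mulnA leq_mul2l; apply/orP; right; nia.
  have hK : ((2 * g * B).+1 <= c0 * s.+1)%N.
    apply: (@leq_trans (1 + 2 * g * ((l * D.+1 + 1) * s.+1))%N).
      by rewrite add1n ltnS leq_mul2l hB orbT.
    by rewrite /c0 [X in (_ <= X)%N]mulSn mulnA leq_add2r.
  have mono x y e : (x <= y)%N -> (x ^ e <= y ^ e)%N.
    by move=> xy; elim: e => // e IH; rewrite !expnS leq_mul.
  rewrite !card_ffun !card_ord (leq_ltn_trans (mono _ _ rho hK)) //.
  rewrite expnMn -/s (@leq_trans (s.+1 ^ rho.+1)%N) ?leq_pexp2l //.
  by rewrite expnS ltn_pmul2r // expn_gt0.
have [c [a0 ca0] hc] := prime_dependence (primeC 0%N isT) annC outT keyP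
  (fun a : {ffun 'I_l -> 'I_s.+1} => msize_prod_le a hD) cardKA.
have := @chain_independent l s C Fs primeC (fun j f jl => (chainC j jl).1 f) FsC FsNC
  0%N [set a | c a != 0] c isT.
apply.
- by apply/set0Pn; exists a0; rewrite inE.
- by move=> a; rewrite inE.
- by [].
- rewrite (_ : \sum_(_ in _) _ = \sum_a c a *: \prod_(t < l) Fs t ^+ a t) //.
  rewrite [RHS](bigID (fun a => c a != 0)) /= [X in _ + X]big1 ?addr0.
    by apply: eq_bigl => a; rewrite inE.
  by move=> a /negPn/eqP ->; rewrite scale0r.
Qed.

End KrullUpper.

Lemma big_partition_seq (R : nmodType) (I J : eqType) (s : seq I) (P : pred I)
    (key : I -> J) (G : I -> R) :
  \sum_(i <- s | P i) G i =
  \sum_(x <- undup (map key s)) \sum_(i <- s | P i && (key i == x)) G i.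
Proof.
rewrite (exchange_big_dep P) /= => [|x i _ /andP[]//].
rewrite big_seq_cond [RHS]big_seq_cond; apply: eq_bigr => i /andP[si Pi].
have xs : key i \in undup (map key s) by rewrite mem_undup map_f.
rewrite big_mkcond (bigD1_seq (key i)) ?undup_uniq //= Pi eqxx big1 ?addr0 // => x.
by rewrite eq_sym => /negPf ->.
Qed.

(** * Lower bound: toric primes *)

Section Toric.
Variables (F : fieldType) (d r : nat) (gens : 'I_r -> 'rV[int]_d) (T : {set 'I_r}).
Notation n := (gens_rank gens T).
Notation K := {fraction {mpoly F[n]}}.
Implicit Types (m : 'X_{1..r}) (f : {mpoly F[r]}) (w : 'rV[int]_n).

Definition frac_cst : F -> K := @tofrac _ \o @mpolyC n F.
HB.instance Definition _ := GRing.RMorphism.on frac_cst.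

Definition frac_var (t : 'I_n) : K := tofrac 'X_t.

(** The fraction field serves as target because coordinates of generators may be negative; being a
    field, it makes all the kernels prime. *)
Definition laurent w : K := \prod_t frac_var t ^ (w 0 t).

Definition trunc_deg (e : nat) (a : 'rV[int]_d) : 'rV[int]_n :=
  \row_t if (t < e)%N then a 0 (coords t) else 0.

Definition toric_map (e : nat) : {mpoly F[r]} -> K :=
  mmap frac_cst (fun i => if i \in T then laurent (trunc_deg e (gens i)) else 0).
HB.instance Definition _ e := GRing.RMorphism.on (toric_map e).

(* As [e] decreases from the rank of [T] to 0, these kernels form a strictly
   increasing chain of primes. *)
Definition toric (e : nat) f : Prop := toric_map e f = 0.

Lemma frac_var_neq0 t : frac_var t != 0.
Proof. by rewrite tofrac_eq0 -msupp_eq0 msuppX. Qed.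

Lemma toric_prime e : prime_ideal (toric e).
Proof.
have tD f g : toric_map e (f + g) = toric_map e f + toric_map e g by exact: rmorphD.
have tM f g : toric_map e (f * g) = toric_map e f * toric_map e g by exact: rmorphM.
rewrite /toric; split; first exact: rmorph0.
split; first by move=> f g hf hg; rewrite tD hf hg addr0.
split; first by move=> f g hg; rewrite tM hg mulr0.
split; first by rewrite rmorph1 => /eqP; rewrite oner_eq0.
move=> f g; rewrite tM => /eqP; rewrite mulf_eq0.
by case/orP => /eqP; [left|right].
Qed.

Lemma laurentD w w' : laurent (w + w') = laurent w * laurent w'.
Proof.
rewrite /laurent -big_split; apply: eq_bigr => t _.
by rewrite mxE expfzDr // frac_var_neq0.
Qed.

Lemma laurent0 : laurent 0 = 1.
Proof. by rewrite /laurent big1 // => t _; rewrite mxE expr0z. Qed.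

Lemma laurentMn w k : laurent (w *+ k) = laurent w ^+ k.
Proof.
by elim: k => [|k IH]; rewrite ?mulr0n ?laurent0 ?expr0 // mulrS laurentD IH exprS.
Qed.

Lemma trunc_deg_mexp e m :
  trunc_deg e (mexp gens m) = \sum_i trunc_deg e (gens i) *+ m i.
Proof.
apply/rowP => t; rewrite mxE summxE /mexp summxE.
case te : (t < e)%N; last by rewrite big1 // => i _; rewrite mulmxnE mxE te mul0rn.
by apply: eq_bigr => i _; rewrite !mulmxnE mxE te.
Qed.

Lemma toric_map_monom e m :
  mmap1 (fun i => if i \in T then laurent (trunc_deg e (gens i)) else 0) m =
  if supported T m then laurent (trunc_deg e (mexp gens m)) else 0.
Proof.
rewrite /mmap1; case: ifPn => [/supportedP sm|/forallPn[i]].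
  rewrite trunc_deg_mexp (big_morph laurent laurentD laurent0).
  apply: eq_bigr => i _; rewrite laurentMn; case: ifP => // /negbT/sm ->.
  by rewrite !expr0.
rewrite negb_imply => /andP[iT mi].
by rewrite (bigD1 i) //= (negPf iT) expr0n (negPf mi) mul0r.
Qed.

Lemma toric_mapE e f : toric_map e f =
  \sum_(m <- msupp f | supported T m) frac_cst f@_m * laurent (trunc_deg e (mexp gens m)).
Proof.
rewrite /toric_map /mmap [RHS]big_mkcond; apply: eq_bigr => m _.
by rewrite toric_map_monom; case: ifP; rewrite ?mulr0.
Qed.

(** Distinct Laurent monomials are linearly independent over [F], so the image vanishes exactly when
    the coefficients collected in each degree do. *)
Lemma toricP e f : toric e f <-> forall w,
  coefsum (fun m => supported T m && (trunc_deg e (mexp gens m) == w)) f = 0.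
Proof.
rewrite /toric toric_mapE; split=> [f0 w|h]; last first.
  rewrite (big_partition_seq _ _ (fun m => trunc_deg e (mexp gens m))) big1 // => w _.
  under eq_bigr => m /andP[_ /eqP ->] do [].
  by rewrite -mulr_suml -rmorph_sum (h w : \sum_(_ <- _ | _) _ = 0) rmorph0 mul0r.
(* A common shift by [B] turns all exponents that occur into natural numbers. [w] joins the list so
   that its shifted monomial is comparable with theirs even if [w] does not occur. *)
pose ws := w :: [seq trunc_deg e (mexp gens m) | m <- msupp f].
pose B := (\max_(w' <- ws) \max_t `|w' (ord0 : 'I_1) t|)%N.
have hB w' t : w' \in ws -> (`|w' ord0 t| <= B)%N.
  move=> ww; rewrite /B (big_rem w') //=.
  by apply: leq_trans (leq_maxl _ _); exact: (leq_bigmax t).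
pose mon w' : 'X_{1..n} := [multinom absz (w' ord0 t + B%:Z)%R | t < n].
have monE w' : w' \in ws ->
    laurent w' * laurent (const_mx B%:Z) = tofrac 'X_[mon w'].
  move=> ww; rewrite -laurentD /laurent mpolyXE_id rmorph_prod; apply: eq_bigr => t _.
  rewrite rmorphXn /= mnmE !mxE exprnP gez0_abs //.
  by have := hB _ t ww; lia.
have mon_inj w' w'' : w' \in ws -> w'' \in ws -> mon w' = mon w'' -> w' = w''.
  move=> h' h'' /mnmP E; apply/rowP => t; have := E t; rewrite !mnmE.
  have := hB _ t h'; have := hB _ t h''; rewrite (_ : ord0 = 0) //.
  move: (w' 0 t) (w'' 0 t) => x y; lia.
pose g : {mpoly F[n]} := \sum_(m <- msupp f | supported T m)
  f@_m *: 'X_[mon (trunc_deg e (mexp gens m))].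
have mws m : m \in msupp f -> trunc_deg e (mexp gens m) \in ws.
  move=> mf; rewrite inE; apply/orP; right.
  exact: (map_f (fun m => trunc_deg e (mexp gens m))) mf.
have g0 : g = 0.
  apply/eqP; rewrite -tofrac_eq0 rmorph_sum /=; apply/eqP.
  transitivity ((\sum_(m <- msupp f | supported T m)
    frac_cst f@_m * laurent (trunc_deg e (mexp gens m))) * laurent (const_mx B%:Z)).
    rewrite mulr_suml big_seq_cond [RHS]big_seq_cond; apply: eq_bigr => m /andP[mf _].
    by rewrite -mulrA monE ?mws // -mul_mpolyC rmorphM.
  by rewrite f0 mul0r.
have := congr1 (mcoeff (mon w)) g0; rewrite mcoeff0 raddf_sum /= => <-.
rewrite /coefsum big_mkcondr big_seq_cond [RHS]big_seq_cond.
apply: eq_bigr => m /andP[mf _]; rewrite mcoeffZ mcoeffX.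
case: eqP => [->|ne]; first by rewrite eqxx mulr1.
case: eqP => [/mon_inj E|_]; last by rewrite mulr0.
by case: ne; apply: E; [exact: mws | rewrite inE eqxx].
Qed.

Lemma toric_mono e f : toric e.+1 f -> toric e f.
Proof.
move=> /toricP h; apply/toricP => w.
pose tr (w' : 'rV[int]_n) : 'rV[int]_n := \row_t if (t < e)%N then w' 0 t else 0.
have trE a : tr (trunc_deg e.+1 a) = trunc_deg e a.
  by apply/rowP => t; rewrite !mxE; case: ltnP => // te; rewrite (leqW te : (t < e.+1)%N).
rewrite /coefsum (big_partition_seq _ _ (fun m => trunc_deg e.+1 (mexp gens m))).
rewrite big1 // => w' _; have [<-|ne] := eqVneq (tr w') w; last first.
  rewrite big1 // => m /andP[/andP[_ /eqP tw] /eqP tw'].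
  by case/eqP: ne; rewrite -tw' trE.
rewrite -[RHS](h w'); apply: eq_bigl => m; rewrite -andbA; congr (_ && _).
by rewrite andbC; case: eqP => //= <-; rewrite trE eqxx.
Qed.

(* A relation between generators that holds in the first [e] coordinates but
   not in the next one gives a binomial. *)
Lemma toric_strict e : (e < n)%N -> exists f, toric e f /\ ~ toric e.+1 f.
Proof.
move=> en; pose t0 : 'I_n := Ordinal en.
pose A := rowsub (maxrankfun (gens_mx gens T)^T) (gens_mx gens T)^T.
have frA : row_free A by rewrite /row_free eq_maxrowsub.
pose t1 := cast_ord (esym (mxrank_tr (gens_mx gens T))) t0.
(* A rational combination of the generators whose selected coordinates form the unit vector at [t0].
   Clearing denominators by [D] and separating signs gives the two monomials. *)
have [u uE] : exists u : 'cV[rat]_r, A *m u = delta_mx t1 0.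
  by exists (pinvmx A *m delta_mx t1 0); rewrite mulmxA mulmxVp // mul1mx.
pose D : int := \prod_i denq (u i 0); pose c i : int := numq (u i 0) * \prod_(j | j != i) denq (u j 0).
have D0 : D != 0 by rewrite prodf_seq_neq0; apply/allP => i _; rewrite denq_neq0.
have cE i : (c i)%:~R = D%:~R * u i 0.
  rewrite /c /D [X in _ = X%:~R * _](bigD1 i) //= !intrM numqE; ring.
pose mp : 'X_{1..r} := [multinom if (i \in T) && ((0:int) <= c i)%R then absz (c i) else 0%N | i < r].
pose mn : 'X_{1..r} := [multinom if (i \in T) && (c i < (0:int))%R then absz (c i) else 0%N | i < r].
have smp : supported T mp by apply/supportedP => i /negPf iT; rewrite mnmE iT.
have smn : supported T mn by apply/supportedP => i /negPf iT; rewrite mnmE iT.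
have dif t : mexp gens mp 0 (coords t) - mexp gens mn 0 (coords t) = D *+ (t == t0).
  apply: (@intr_inj rat).
  transitivity (D%:~R * (A *m u) (cast_ord (esym (mxrank_tr (gens_mx gens T))) t) 0); last first.
    by rewrite uE mxE eqxx andbT (inj_eq (@cast_ord_inj _ _ _)) rmorphMn mulr_natr.
  rewrite rmorphB /mexp !summxE !rmorph_sum -sumrB mxE mulr_sumr /=.
  apply: eq_bigr => i _; rewrite !mxE !mulmxnE -/(coords t) mulrCA -cE !mnmE.
  case: (i \in T) => /=; last by rewrite !mulr0n mul0r subrr.
  rewrite -rmorphB -rmorphM /=; congr (_ %:~R); case: ltrP => ci.
    by rewrite mulr0n sub0r -mulr_natr -mulrN natz ltz0_abs // opprK.
  by rewrite mulr0n subr0 -mulr_natr natz gez0_abs.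
exists ('X_[mp] - 'X_[mn]); split.
  apply/toricP => w; rewrite -scaleN1r coefsumD coefsumZ !coefsumX smp smn /=.
  have -> : trunc_deg e (mexp gens mp) = trunc_deg e (mexp gens mn); last by rewrite mulN1r subrr.
  apply/rowP => t; rewrite !mxE; case: ifP => // te; apply/eqP; rewrite -subr_eq0 dif.
  by rewrite -val_eqE /= (ltn_eqF te).
move=> /toricP/(_ (trunc_deg e.+1 (mexp gens mp))).
rewrite -scaleN1r coefsumD coefsumZ !coefsumX smp smn eqxx /=.
case: eqP => [/rowP/(_ t0)|_]; last by move/eqP; rewrite mulr0 addr0 oner_eq0.
rewrite !mxE /= ltnSn => E; have := dif t0; rewrite E subrr eqxx mulr1n => /esym/eqP.
by rewrite (negPf D0).
Qed.

End Toric.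

Section KrullLower.
Variables (F : fieldType) (d r : nat) (gens : 'I_r -> 'rV[int]_d) (M : qmod F d).
Hypothesis modM : is_qmod gens M.

Lemma qact_eq0_trans q q' q'' : in_sg gens (q' - q) -> in_sg gens (q'' - q') ->
  qact M q q' = 0 -> qact M q q'' = 0.
Proof. by case: modM => _ h h1 h2 E; rewrite -(h _ _ _ h1 h2) E mul0mx. Qed.

Lemma gens_rank_sub (T T' : {set 'I_r}) : T \subset T' ->
  (gens_rank gens T <= gens_rank gens T')%N.
Proof.
move=> /subsetP sT.
have -> : gens_rank gens T = \rank (diag_mx (\row_i (i \in T)%:R) *m gens_mx gens T').
  congr (\rank _); apply/matrixP => i j; rewrite mul_diag_mx !mxE.
  by case: ifP => [/sT ->|_]; rewrite ?mul1r ?mul0r.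
exact: mxrankM_maxr.
Qed.

Lemma prime_chain_leq l l' : (l <= l')%N -> prime_chain gens M l' -> prime_chain gens M l.
Proof.
move=> ll [C [h1 [h2 h3]]]; exists C; split; first by move=> j jl; apply/h1/(leq_trans jl).
by split=> // j jl; apply/h3/(leq_trans jl).
Qed.

(** Maximality of [T] serves to put the annihilator inside the smallest kernel: every monomial of
    the same degree as a supported one is itself supported, so the coefficient sums in the two
    conditions are the same. *)
Lemma toric_chain (T : {set 'I_r}) : unbounded gens M T ->
  (forall i, i \notin T -> ~ unbounded gens M (i |: T)) ->
  prime_chain gens M (gens_rank gens T).
Proof.
move=> unbT maxT; set n := gens_rank gens T.
exists (fun j => @toric F d r gens T (n - j)); split; first by move=> j _; exact: toric_prime.
split=> [f annf|j jn]; last first.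
  have njE : (n - j = (n - j.+1).+1)%N by lia.
  rewrite njE; split; first by move=> f; exact: toric_mono.
  have [|f [f1 f2]] := @toric_strict F d r gens T (n - j.+1); first by rewrite -/n; lia.
  by exists f.
rewrite subn0; apply/toricP => w.
case: (classic (exists2 m0, m0 \in msupp f &
    supported T m0 && (trunc_deg gens T n (mexp gens m0) == w)))
  => [[m0 m0f /andP[sm0 m0w]]|no]; last first.
  by rewrite /coefsum big_seq_cond big1 // => m /andP[mf hm]; case: no; exists m.
set v := mexp gens m0.
pose deg0 := (\sum_i m0 i)%N.
(* x^v divides a power of x_T *)
have divT k : in_sg gens (sum_gens gens T *+ (k * deg0) - v *+ k).
  have -> : sum_gens gens T *+ (k * deg0) - v *+ k =
      (\sum_(i in T) gens i *+ (deg0 - m0 i)) *+ k.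
    rewrite mulnC mulrnA -mulrnBl; congr (_ *+ k).
    rewrite /sum_gens -sumrMnl /v /mexp [X in _ - X](bigID (mem T)) /=.
    rewrite [X in _ - (_ + X)]big1 ?addr0 => [|i iT]; last first.
      by move/supportedP: sm0 => ->.
    rewrite -sumrB; apply: eq_bigr => i _; rewrite mulrnBr //.
    by rewrite /deg0 (bigD1 i) //= leq_addr.
  by apply: in_sgMn; apply: in_sg_sum => i _; exact/in_sgMn/in_sg_gen.
(* If [X_i] with [i \notin T] divided a monomial of degree [v], every power of [x_(i |: T)] would
   divide a power of [x_T], and [i |: T] would be unbounded as well. *)
have suppv m : mexp gens m = v -> supported T m.
  move=> mv; apply/supportedP => i iT; apply: NNPP => /eqP; rewrite -lt0n => mi.
  apply: (maxT i iT) => k; apply: NNPP => nex.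
  have [q] := unbT (k * deg0 + k)%N; apply.
  apply: (@qact_eq0_trans q (q + sum_gens gens (i |: T) *+ k)).
  - rewrite addrC addKr; apply/in_sgMn/in_sg_sum => j _; exact: in_sg_gen.
  - rewrite opprD addrACA subrr add0r.
    have -> : sum_gens gens T *+ (k * deg0 + k) - sum_gens gens (i |: T) *+ k =
      (sum_gens gens T *+ (k * deg0) - v *+ k) + (v - gens i) *+ k.
      rewrite [sum_gens gens (_ |: _)]big_setU1 //= mulrnDr mulrnDl mulrnBl.
      by rewrite [gens i *+ k + _]addrC opprD addrA addrK addrA subrK.
    apply: in_sgD => //; apply: in_sgMn.
    exists (fun j => m j - (j == i))%N; rewrite -mv /mexp (bigD1 i) //= [RHS](bigD1 i) //=.
    rewrite eqxx addrAC mulrnBr // mulr1n; congr (_ + _).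
    by apply: eq_bigr => j /negPf ->; rewrite subn0.
  - by apply: NNPP => h; apply: nex; exists q.
have [q qv] : exists q, qact M q (q + v) <> 0.
  have [q hq] := unbT deg0; exists q => E; apply: hq.
  apply: qact_eq0_trans E; first by rewrite addrC addKr; exact: in_sg_mexp.
  by have := divT 1%N; rewrite mul1n mulr1n opprD addrACA subrr add0r.
have := annf q (q + v); rewrite addrC addKr => /(_ (in_sg_mexp _ _)).
move=> /eqP; rewrite scaler_eq0 => /orP[/eqP f0|/eqP/qv[]].
rewrite -[RHS]f0; apply: eq_bigl => m.
rewrite (inj_eq (addrI q)); apply/andP/eqP => [[sm /eqP mw]|mv].
  apply: (coords_inj sm sm0) => t; move: m0w; rewrite -mw => /eqP/rowP/(_ t).
  by rewrite !mxE ltn_ord.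
by split; [exact: suppv | rewrite mv].
Qed.

(** [T] is enlarged until it is maximal; the rank can only grow, and a longer chain contains a
    shorter one. *)
Lemma krull_lower (T : {set 'I_r}) : unbounded gens M T ->
  prime_chain gens M (gens_rank gens T).
Proof.
have [k] := ubnP #|~: T|; elim: k T => // k IH T lt unbT.
case: (classic (exists2 i, i \notin T & unbounded gens M (i |: T))) => [[i iT unb]|no].
  apply: prime_chain_leq (gens_rank_sub (subsetUr [set i] T)) (IH _ _ unb).
  rewrite -ltnS (leq_trans _ lt) // ltnS; apply: proper_card.
  rewrite properEneq setCS subsetUr andbT; apply/eqP => /setP/(_ i).
  by rewrite !inE eqxx (negPf iT).
by apply: toric_chain => // i iT unb; apply: no; exists i.
Qed.

Lemma krull_dim_unbounded delta : krull_dim gens M delta ->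
  (exists2 T, unbounded gens M T & gens_rank gens T = delta) /\
  (forall T, unbounded gens M T -> (gens_rank gens T <= delta)%N).
Proof.
move=> [h nh].
have max T : unbounded gens M T -> (gens_rank gens T <= delta)%N.
  by move=> /krull_lower hT; rewrite leqNgt; apply/negP => lt; apply: nh; apply: prime_chain_leq hT.
split=> //; have [T unbT le] := krull_upper h.
by exists T => //; apply/eqP; rewrite eqn_leq max.
Qed.

End KrullLower.

(** * Finite generation and definability *)

Section Dickson.
Variable I : finType.
Implicit Types (U W : {ffun I -> nat} -> Prop).

Definition has_basis U : Prop := exists2 gs : seq {ffun I -> nat},
  forall g, g \in gs -> U g & forall u, U u -> exists2 g, g \in gs & forall i, (g i <= u i)%N.

Lemma has_basisU U W Z : (forall u, Z u <-> U u \/ W u) ->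
  has_basis U -> has_basis W -> has_basis Z.
Proof.
move=> E [gs h1 h2] [gs' h1' h2']; exists (gs ++ gs') => [g|u].
  by rewrite mem_cat E => /orP[/h1|/h1']; [left|right].
by rewrite E => -[/h2|/h2'] [g gg le]; exists g; rewrite // mem_cat gg ?orbT.
Qed.

Lemma has_basis0 U : (forall u, ~ U u) -> has_basis U.
Proof. by move=> h; exists [::] => // u /h. Qed.

(** Induction on the number of coordinates in which elements may differ. An element not above a
    fixed [u0] has some coordinate equal to one of the finitely many values below that of [u0], and
    fixing this coordinate lowers the count. *)
Lemma dickson U : has_basis U.
Proof.
suff h (n : nat) (s : seq I) W : (size s <= n)%N ->
    (forall u u', W u -> W u' -> forall i, i \notin s -> u i = u' i) -> has_basis W.
  by apply: (h _ (enum I) U (leqnn _)) => u u' _ _ i; rewrite mem_enum.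
elim: n s W => [|n IH] s W sn agW; case: (classic (exists u, W u)) => [[u0 Wu0]|no];
    try by apply: has_basis0 => u Wu; apply: no; exists u.
  exists [:: u0] => [g|u Wu]; first by rewrite inE => /eqP ->.
  exists u0; rewrite ?inE // => i; rewrite (agW u0 u) //.
  by move: sn; rewrite leqn0 size_eq0 => /eqP ->.
have eqi i c : i \in s -> has_basis (fun u => W u /\ u i = c).
  move=> si; apply: (IH [seq j <- s | j != i]).
    rewrite -ltnS (leq_trans _ sn) // size_filter -(count_predC (pred1 i) s).
    by rewrite -[X in (X < _)%N]add0n ltn_add2r -has_count has_pred1.
  move=> u u' [Wu ui] [Wu' ui'] j; rewrite mem_filter negb_and negbK.
  by case/orP => [/eqP ->|/agW]; [rewrite ui ui' | apply].
have lti i c : i \in s -> has_basis (fun u => W u /\ (u i < c)%N).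
  move=> si; elim: c => [|c IHc]; first by apply: has_basis0 => u [].
  apply: has_basisU IHc (eqi i c si) => u; rewrite ltnS leq_eqVlt.
  by split=> [[Wu /orP[/eqP|]]|[[Wu ->]|[Wu ->]]]; rewrite ?eqxx ?orbT; auto.
have some (t : seq I) : {subset t <= s} ->
    has_basis (fun u => W u /\ exists2 i, i \in t & (u i < u0 i)%N).
  elim: t => [|i t IHt] ts; first by apply: has_basis0 => u [_ []].
  have ts' : {subset t <= s} by move=> j jt; apply: ts; rewrite inE jt orbT.
  apply: has_basisU (lti i (u0 i) (ts i (mem_head _ _))) (IHt ts') => u.
  split=> [[Wu [j]]|[[Wu lt]|[Wu [j jt lt]]]].
  - by rewrite inE => /orP[/eqP ->|jt] lt; [left|right; split=> //; exists j].
  - by split=> //; exists i; rewrite ?mem_head.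
  - by split=> //; exists j; rewrite // inE jt orbT.
have [gs h1 h2] := some s (fun _ => id).
exists (u0 :: gs) => [g|u Wu]; first by rewrite inE => /orP[/eqP ->|/h1[]].
case: (classic (exists2 i, i \in s & (u i < u0 i)%N)) => [lt|nlt].
  by have [g gg le] := h2 u (conj Wu lt); exists g; rewrite // inE gg orbT.
exists u0; rewrite ?mem_head // => i; rewrite leqNgt; apply/negP => lt; apply: nlt.
exists i => //; apply/negPn/negP => si; move: lt.
by rewrite (agW u u0 Wu Wu0 i si) ltnn.
Qed.

End Dickson.

Section MonomialIdeal.
Variables (d r : nat) (gens : 'I_r -> 'rV[int]_d) (E : 'rV[int]_d -> Prop).
Hypothesis idE : monomial_ideal gens E.

Lemma monomial_ideal_fg : exists gs : seq 'rV[int]_d, forall a,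
  E a <-> exists2 g, g \in gs & in_sg gens (a - g).
Proof.
have [Esg Emul] := idE.
pose ev (u : {ffun 'I_r -> nat}) : 'rV[int]_d := \sum_i gens i *+ u i.
have [gs h1 h2] := dickson (fun u => E (ev u)).
exists (map ev gs) => a; split=> [Ea|[_ /mapP[u /h1 Eu ->] sg]]; last first.
  by rewrite -(subrK (ev u) a) addrC; exact: Emul.
have [c ac] := Esg a Ea.
have aE : a = ev [ffun i => c i] by rewrite ac; apply: eq_bigr => i _; rewrite ffunE.
have [|g gg le] := h2 [ffun i => c i]; first by rewrite -aE.
exists (ev g); first exact: map_f.
exists (fun i => c i - g i)%N; rewrite aE /ev -sumrB; apply: eq_bigr => i _.
by have := le i; rewrite ffunE => lei; rewrite mulrnBr.
Qed.

(** Counting how often each generator is used replaces [m] unknown exponents by [size gs] unknown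
    numbers, so that [m] itself can become a Presburger variable. *)
Lemma pow_expsP (gs : seq 'rV[int]_d) :
  (forall a, E a <-> exists2 g, g \in gs & in_sg gens (a - g)) ->
  forall (m : nat) (a : 'rV[int]_d), pow_exps gens E m a <-> exists b : 'I_(size gs) -> nat,
    (\sum_(t < size gs) b t)%N = m /\ in_sg gens (a - \sum_(t < size gs) gs`_t *+ b t).
Proof.
move=> Egs m a; split=> [[b [Eb sg]]|[b [bm sg]]].
  have ex j : exists t : 'I_(size gs), in_sg gens (b j - gs`_t).
    have /Egs[g gg sgj] := Eb j.
    have lt : (index g gs < size gs)%N by rewrite index_mem.
    by exists (Ordinal lt); rewrite /= nth_index.
  have [c hc] := fin_all_exists ex.
  exists (fun t => #|[set j | c j == t]|); split.
    rewrite -[RHS]card_ord -sum1_card (partition_big c xpredT) //=.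
    by apply: eq_bigr => t _; rewrite sum1_card cardsE.
  have -> : \sum_(t < size gs) gs`_t *+ #|[set j | c j == t]| = \sum_j gs`_(c j).
    rewrite [RHS](partition_big c xpredT) //=; apply: eq_bigr => t _.
    by rewrite -sumr_const; apply: eq_big => [j|j]; rewrite inE // => /eqP ->.
  rewrite -(subrK (\sum_j b j) a) -addrA -sumrB; apply: in_sgD => //.
  exact: in_sg_sum.
pose L := flatten [seq nseq (b t) gs`_t | t <- enum 'I_(size gs)].
have sL : size L = m.
  rewrite size_flatten /shape -map_comp sumnE big_map big_enum /= -bm.
  by apply: eq_bigr => t _; rewrite size_nseq.
have LE x : x \in L -> E x.
  case/flattenP => _ /mapP[t _ ->] /nseqP[-> _]; apply/Egs.
  by exists gs`_t; [exact: mem_nth | rewrite subrr; exact: in_sg0].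
have sumL : \sum_(x <- L) x = \sum_(t < size gs) gs`_t *+ b t.
  rewrite big_flatten big_map big_enum /=; apply: eq_bigr => t _.
  by rewrite big_nseq iter_addr_0.
exists (fun j => L`_j); split; first by move=> j; apply/LE/mem_nth; rewrite sL.
suff -> : \sum_(j < m) L`_j = \sum_(x <- L) x by rewrite sumL.
by rewrite [RHS](big_nth 0) sL big_mkord.
Qed.

End MonomialIdeal.

Lemma scale_posz n (c : nat) (x : 'rV[int]_n) : c%:Z *: x = x *+ c.
Proof. by rewrite -natz scaler_nat. Qed.

Definition affine_row (V : finType) (n : nat) (a : env V -> 'rV[int]_n) : Prop :=
  forall j, affine (fun e => a e 0 j).

(** * Presburger definability of semigroup, powers and regions *)

Section Definability.
Variables (V : finType).

Lemma affine_inl (W : finType) (l : env V -> int) :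
  affine l -> affine (fun e : env (V + W)%type => l [ffun x => e (inl x)]).
Proof.
move=> hl; apply: (affine_comp hl) => x.
by apply: affine_ext (affine_var (inl x)) _ => e; rewrite ffunE.
Qed.

Lemma definable_ex_row n (A : env V -> 'rV[int]_n -> Prop) :
  definable (fun e : env (V + 'I_n)%type => A [ffun x => e (inl x)] (\row_j e (inr j))) ->
  definable (fun e => exists a, A e a).
Proof.
move=> hA; have h : definable (fun e : env V => exists w : env 'I_n, A e (\row_j w j)).
  apply: definable_ex; apply: definable_ext hA _ => e.
  by have -> : \row_j ([ffun y => e (inr y)] : env 'I_n) j = \row_j e (inr j)
    by apply/rowP => j; rewrite !mxE ffunE.
apply: definable_ext h _ => e; split=> [[w Aw]|[a Aa]]; first by exists (\row_j w j).
exists [ffun j => a 0 j]; suff -> : \row_j [ffun j => a 0 j] j = a by [].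
by apply/rowP => j; rewrite mxE ffunE.
Qed.

Lemma definable_row_eq n (a b : env V -> 'rV[int]_n) :
  affine_row a -> affine_row b -> definable (fun e => a e = b e).
Proof.
move=> ha hb; apply: definable_ext (definable_all_fin (fun j => definable_eq (ha j) (hb j))) _.
by move=> e; split=> [h|-> //]; apply/rowP.
Qed.

(* Natural coefficients are encoded by nonnegative integers. *)
Lemma definable_ex_nat n (A : env V -> ('I_n -> int) -> Prop) :
  (forall e c c', c =1 c' -> A e c -> A e c') ->
  definable (fun e : env (V + 'I_n)%type => A [ffun x => e (inl x)] (fun j => e (inr j))) ->
  definable (fun e => exists c : 'I_n -> nat, A e (fun j => (c j)%:Z)).
Proof.
move=> extA hA; have h : definable (fun e : env V => exists w : env 'I_n,
    (forall j, 0 <= w j) /\ A e w).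
  apply: definable_ex; have hpos : definable (fun e : env (V + 'I_n)%type =>
      forall j, 0 <= e (inr j)).
    by apply: definable_all_fin => j; exact: definable_le (affine_const _ 0) (affine_var _).
  apply: definable_ext (definable_and hpos hA) _ => e; split=> -[pos Aw].
    split=> [j|]; first by rewrite ffunE.
    by apply: extA Aw => j; rewrite ffunE.
  split=> [j|]; first by have := pos j; rewrite ffunE.
  by apply: extA Aw => j; rewrite ffunE.
apply: definable_ext h _ => e; split=> [[w [pos Aw]]|[c Ac]].
  by exists (fun j => absz (w j)); apply: extA Aw => j; rewrite gez0_abs.
exists [ffun j => (c j)%:Z]; split=> [j|]; first by rewrite ffunE.
by apply: extA Ac => j; rewrite ffunE.
Qed.

Lemma affine_row_sub n (a b : env V -> 'rV[int]_n) :
  affine_row a -> affine_row b -> affine_row (fun e => a e - b e).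
Proof. by move=> ha hb j; apply: affine_ext (affine_sub (ha j) (hb j)) _ => e; rewrite !mxE. Qed.

Lemma affine_row_add n (a b : env V -> 'rV[int]_n) :
  affine_row a -> affine_row b -> affine_row (fun e => a e + b e).
Proof. by move=> ha hb j; apply: affine_ext (affine_add (ha j) (hb j)) _ => e; rewrite !mxE. Qed.

Lemma affine_row_scale n (g : 'rV[int]_n) (l : env V -> int) :
  affine l -> affine_row (fun e => l e *: g).
Proof. by move=> hl j; apply: affine_ext (affine_scale (g 0 j) hl) _ => e; rewrite mxE mulrC. Qed.

Lemma affine_row_sum n (I : finType) (a : I -> env V -> 'rV[int]_n) :
  (forall i, affine_row (a i)) -> affine_row (fun e => \sum_i a i e).
Proof.
move=> ha j; apply: (@affine_ext _ (fun e => \sum_i a i e 0 j)) => [|e].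
  by apply: affine_sum => i; exact: ha.
by rewrite summxE.
Qed.

Lemma affine_row_const n (a : 'rV[int]_n) : affine_row (fun _ : env V => a).
Proof. by move=> j; exact: affine_const. Qed.

End Definability.

Lemma affine_row_inl (V W : finType) n (a : env V -> 'rV[int]_n) :
  affine_row a -> affine_row (fun e : env (V + W)%type => a [ffun x => e (inl x)]).
Proof. by move=> ha j; exact: affine_inl (ha j). Qed.

Lemma affine_row_var (V : finType) n (v : 'I_n -> V) : affine_row (fun e : env V => \row_j e (v j)).
Proof. by move=> j; apply: affine_ext (affine_var (v j)) _ => e; rewrite mxE. Qed.

Lemma affine_row_comb (V : finType) (s n : nat) (g : 'I_s -> 'rV[int]_n) :
  affine_row (fun e : env (V + 'I_s)%type => \sum_j e (inr j) *: g j).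
Proof. by apply: affine_row_sum => j; exact/affine_row_scale/affine_var. Qed.

Section DefinableSets.
Variables (d r k : nat) (gens : 'I_r -> 'rV[int]_d).

Lemma definable_in_sg (V : finType) (a : env V -> 'rV[int]_d) :
  affine_row a -> definable (fun e => in_sg gens (a e)).
Proof.
move=> ha.
have h : definable (fun e => exists c : 'I_r -> nat, a e = \sum_i (c i)%:Z *: gens i).
  apply: (@definable_ex_nat _ _ (fun e c => a e = \sum_i c i *: gens i)).
    by move=> e c c' cc ->; apply: eq_bigr => i _; rewrite cc.
  exact: definable_row_eq (affine_row_inl _ ha) (affine_row_comb _ _).
apply: definable_ext h _ => e.
by split=> -[c cE]; exists c; rewrite cE; apply: eq_bigr => i _; rewrite scale_posz.
Qed.

Lemma definable_pow_exps (E : 'rV[int]_d -> Prop) (V : finType) (l : env V -> int)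
    (a : env V -> 'rV[int]_d) :
  monomial_ideal gens E -> affine l -> affine_row a ->
  exists2 A : env V -> Prop, definable A &
    forall e m, l e = m%:Z -> (A e <-> pow_exps gens E m (a e)).
Proof.
move=> idE hl ha; have [gs Egs] := monomial_ideal_fg idE.
exists (fun e => exists b : 'I_(size gs) -> nat,
    \sum_(t < size gs) (b t)%:Z = l e /\ in_sg gens (a e - \sum_(t < size gs) (b t)%:Z *: gs`_t)).
  apply: (@definable_ex_nat _ _ (fun e b =>
    \sum_(t < size gs) b t = l e /\ in_sg gens (a e - \sum_(t < size gs) b t *: gs`_t))).
    move=> e b b' bb [<- sg]; split; first by apply: eq_bigr => t _; rewrite bb.
    by under eq_bigr => t _ do rewrite -bb.
  apply: definable_and.
    by apply: definable_eq (affine_sum _ _ (fun t => affine_var _)) (affine_inl _ hl).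
  exact/definable_in_sg/(affine_row_sub (affine_row_inl _ ha) (affine_row_comb _ _)).
move=> e m lE; rewrite (pow_expsP Egs) lE; split=> -[b [bm sg]]; exists b.
  split; first by apply/eqP; rewrite -eqz_nat -bm -[X in X == _]natz natr_sum;
    apply/eqP/eq_bigr => t _; rewrite natz.
  by under eq_bigr => t _ do rewrite -scale_posz.
split; first by rewrite -bm -[RHS]natz natr_sum; apply: eq_bigr => t _; rewrite natz.
by under eq_bigr => t _ do rewrite scale_posz.
Qed.

Lemma definable_semisimple (S : 'rV[int]_k * 'rV[int]_d -> Prop) (V : finType)
    (a : env V -> 'rV[int]_k) (b : env V -> 'rV[int]_d) :
  semisimple S -> affine_row a -> affine_row b -> definable (fun e => S (a e, b e)).
Proof.
move=> [parts [_ [_ SE]]] ha hb.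
have tr p : definable (fun e => in_translate p (a e, b e)).
  have h : definable (fun e => exists c : 'I_(size p.2) -> nat,
      a e = p.1.1 + \sum_j (c j)%:Z *: (p.2`_j).1 /\ b e = p.1.2 + \sum_j (c j)%:Z *: (p.2`_j).2).
    apply: (@definable_ex_nat _ _ (fun e c =>
      a e = p.1.1 + \sum_j c j *: (p.2`_j).1 /\ b e = p.1.2 + \sum_j c j *: (p.2`_j).2)).
      by move=> e c c' cc [-> ->]; split; congr (_ + _); apply: eq_bigr => j _; rewrite cc.
    apply: definable_and.
      exact: definable_row_eq (affine_row_inl _ ha)
        (affine_row_add (affine_row_const _ _) (affine_row_comb _ _)).
    exact: definable_row_eq (affine_row_inl _ hb)
      (affine_row_add (affine_row_const _ _) (affine_row_comb _ _)).
  have pairE (c : nat -> nat) : p.1 + \sum_(j < size p.2) p.2`_j *+ c j =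
      (p.1.1 + \sum_(j < size p.2) (c j)%:Z *: (p.2`_j).1,
       p.1.2 + \sum_(j < size p.2) (c j)%:Z *: (p.2`_j).2).
    apply: injective_projections; rewrite /= raddf_sum; congr (_ + _);
      by apply: eq_bigr => j _; rewrite raddfMn /= scale_posz.
  apply: definable_ext h _ => e; split=> [[c [h1 h2]]|[c cE]].
    (* Translates take coefficients indexed by all natural numbers; those beyond the list of
       generators are irrelevant and set to 0. *)
    pose c0 (j : nat) := if insub j is Some t then c t else 0%N.
    exists c0; rewrite (pairE c0) h1 h2.
    by congr (_ + _, _ + _); apply: eq_bigr => j _; rewrite /c0 valK.
  by exists (fun j => c j); move: cE; rewrite (pairE c) => -[].
apply: definable_ext (definable_ex_fin (fun j : 'I_(size parts) => tr (nth (0, [::]) parts j))) _.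
move=> e; rewrite SE; split=> [[j h]|[j lt h]]; first by exists j.
by exists (Ordinal lt).
Qed.

End DefinableSets.

(** * Hilbert coefficients *)

Section BinomialBasis.

(** The binomial coefficient of [X + a] over [a], as a polynomial in [X]. *)
Definition binp (a : nat) : {poly rat} := (a`!%:R)^-1 *: \prod_(i < a) ('X + (i.+1%:R)%:P).

Lemma binpE a x : (binp a).[x] = (a`!%:R)^-1 * \prod_(i < a) (x + i.+1%:R).
Proof.
rewrite hornerZ horner_prod; congr (_ * _).
by apply: eq_bigr => i _; rewrite hornerD hornerX hornerC.
Qed.

Lemma binp_nat a t : (binp a).[t%:R] = 'C(t + a, a)%:R.
Proof.
rewrite binpE; elim: a => [|a IH]; first by rewrite big_ord0 fact0 invr1 mulr1 addn0 bin0.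
have a1 : a.+1%:R != 0 :> rat by rewrite pnatr_eq0.
have af : a`!%:R != 0 :> rat by rewrite pnatr_eq0 -lt0n fact_gt0.
apply: (mulfI a1); rewrite -natrM addnS -mul_bin_diag natrM -IH factS natrM big_ord_recr /=.
rewrite -natrD addnS; move: (\prod_(i < a) _) => z; field.
by rewrite af addrC natr1.
Qed.

Lemma binp_nabla a x : (binp a.+1).[x] - (binp a.+1).[x - 1] = (binp a).[x].
Proof.
have a1 : a.+1%:R != 0 :> rat by rewrite pnatr_eq0.
have af : a`!%:R != 0 :> rat by rewrite pnatr_eq0 -lt0n fact_gt0.
rewrite !binpE -mulrBr factS natrM [X in X - _]big_ord_recr [X in _ - X]big_ord_recl /=.
have -> : \prod_(i < a) (x - 1 + (bump 0 i).+1%:R) = \prod_(i < a) (x + i.+1%:R).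
  by apply: eq_bigr => i _; rewrite /bump /= add1n -[i.+2]addn1 natrD; ring.
by move: (\prod_(i < a) _) => z; field; rewrite af addrC natr1.
Qed.

Lemma binp_m1 a : (binp a).[-1] = (a == 0%N)%:R.
Proof.
rewrite binpE; case: a => [|a]; first by rewrite big_ord0 fact0 invr1 mulr1.
by rewrite big_ord_recl /= addrC subrr mul0r mulr0.
Qed.

Definition nabla (H : int -> rat) (y : int) : rat := H y - H (y - 1).

Lemma iter_nabla_binp delta (c : nat -> rat) (H : int -> rat) b :
  (forall y, H y = \sum_(j < delta.+1) c j * (binp (delta - j)).[y%:~R]) ->
  forall y, iter b nabla H y = \sum_(j < delta.+1) c j *
    (if (b <= delta - j)%N then (binp (delta - j - b)).[y%:~R] else 0).
Proof.
move=> HE; elim: b => [|b IH] y.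
  by rewrite /= HE; apply: eq_bigr => j _; rewrite subn0.
rewrite iterS /nabla !IH -sumrB; apply: eq_bigr => j _; rewrite -mulrBr; congr (_ * _).
rewrite rmorphB /= rmorph1; have [lt|le] := ltnP b (delta - j).
  have -> : (delta - j - b = (delta - j - b.+1).+1)%N by lia.
  by rewrite (ltnW lt) binp_nabla.
case: leqP => [ge|_]; last by rewrite subrr.
by have -> : (delta - j - b = 0)%N; [lia | rewrite !binpE !big_ord0 subrr].
Qed.

(* The coefficients in the basis [binp] are recovered by backward differences
   at -1. *)
Lemma binp_coef delta (c : nat -> rat) (H : int -> rat) i : (i <= delta)%N ->
  (forall y, H y = \sum_(j < delta.+1) c j * (binp (delta - j)).[y%:~R]) ->
  iter (delta - i) nabla H (-1) = c i.
Proof.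
move=> id HE; rewrite (iter_nabla_binp _ HE).
have lt : (i < delta.+1)%N by [].
rewrite (bigD1 (Ordinal lt)) //= leqnn subnn binp_m1 eqxx mulr1 big1 ?addr0 // => j ne.
case: ifP => [le|_]; last by rewrite mulr0.
rewrite binp_m1 (_ : (_ == 0%N) = false) ?mulr0 //.
have := ltn_ord j; move: ne; rewrite -val_eqE /= => ne jd; apply/negbTE; lia.
Qed.

End BinomialBasis.

(** * Modules described by their regions *)

Section Regions.
Variables (F : fieldType) (d r k : nat) (gens : 'I_r -> 'rV[int]_d) (M : 'rV[int]_k -> qmod F d).
Notation G := ('rV[int]_k * 'rV[int]_d)%type.
Variables (Gp : G -> Prop)
  (phi : forall g h : G, 'M[F]_(qdim (M g.1) g.2, qdim (M h.1) h.2))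
  (N : nat) (reg : G -> 'I_N) (dI : 'I_N -> nat)
  (psi : forall g, 'M[F]_(dI (reg g), qdim (M g.1) g.2))
  (Tm : forall I J : 'I_N, 'M[F]_(dI I, dI J)).
Hypotheses (Gp0 : forall q, Gp (0, q) <-> in_sg gens q)
  (phiE : forall n q q', in_sg gens (q' - q) -> phi (n, q) (n, q') = qact (M n) q q')
  (psiP : forall g, row_free (psi g) && row_full (psi g))
  (psiT : forall g h, Gp (h - g) -> psi g *m phi g h = Tm (reg g) (reg h) *m psi h).

(** Multiplying on the left by the full matrix [psi (n, q)] does not change the row space, that is,
    the image of the multiplication map. *)
Lemma qact_region n q q' : in_sg gens (q' - q) ->
  (qact (M n) q q' :=: Tm (reg (n, q)) (reg (n, q')) *m psi (n, q'))%MS.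
Proof.
move=> sg; rewrite -psiT; last first.
  by rewrite (_ : _ - _ = (0, q' - q)) ?Gp0 //; congr pair; rewrite /= subrr.
rewrite phiE //; apply: eqmx_sym; apply: eqmxMfull.
by case/andP: (psiP (n, q)).
Qed.

Lemma qdim_region n q : qdim (M n) q = dI (reg (n, q)).
Proof. by have /andP[/eqP fr /eqP fu] := psiP (n, q); exact: etrans (esym fu) fr. Qed.

Lemma qact_region_eq0 n q q' : in_sg gens (q' - q) ->
  (qact (M n) q q' = 0) <-> (Tm (reg (n, q)) (reg (n, q')) = 0).
Proof.
move=> /(qact_region n) E; have /andP[free _] := psiP (n, q').
split=> /eqP; first by rewrite -mxrank_eq0 E mxrankMfree // mxrank_eq0 => /eqP.
by rewrite -mxrank_eq0 -(mxrankMfree _ free) -E mxrank_eq0 => /eqP.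
Qed.

Definition region_colen (x : 'I_N * {set 'I_N}) : nat :=
  (dI x.1 - \rank (\sum_(I in x.2) <<Tm I x.1>>)%MS)%N.

Lemma colen_region (E : 'rV[int]_d -> Prop) n m q c (A : {set 'I_N}) :
  monomial_ideal gens E ->
  (forall I, I \in A <-> exists2 a, pow_exps gens E m a & reg (n, q - a) = I) ->
  colen_eq gens E (M n) m q c -> c = region_colen (reg (n, q), A).
Proof.
move=> [Esg _] hA [Js [h1 [h2 ->]]]; apply: (congr2 subn (qdim_region n q)).
have /andP[free _] := psiP (n, q).
have sgE a : pow_exps gens E m a -> in_sg gens (q - (q - a)).
  case=> b [Eb sg]; rewrite subKr -(subrK (\sum_j b j) a); apply: in_sgD => //.
  by apply: in_sg_sum => j _; exact: Esg.
(* The free matrix [psi (n, q)] carries the sum of the images computed in the model space onto the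
   image of the power of the ideal in degree [q], without loss of rank. *)
rewrite -(mxrankMfree _ free); apply: eqmx_rank; apply/andP; split.
  rewrite big_seq; apply: (big_ind (fun B => (B <= _)%MS)) => [|B B' hB hB'|b bJ].
  - exact: sub0mx.
  - by rewrite addsmx_sub hB.
  rewrite genmxE (qact_region _ (sgE b (h1 b bJ))); apply: submxMr.
  apply: (sumsmx_sup (reg (n, q - b))); last by rewrite genmxE.
  by apply/hA; exists b => //; exact: h1.
rewrite sumsmxMr_gen; apply/sumsmx_subP => I /hA[a pa <-].
by rewrite genmxE (eqmxMr _ (genmxE _)) -(qact_region _ (sgE a pa)); exact: h2.
Qed.

End Regions.

Lemma pwq_finite (V : finType) (A : finType) (X : env V -> A) (g : A -> rat) :
  (forall a, definable (fun e => X e = a)) -> pwq 0 (fun e => g (X e)).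
Proof.
move=> hX.
have h a : pwq 0 (fun e => if X e == a then g a else 0).
  have [P hP PE] := hX a.
  apply: pwq_ext (pwq_if_pres hP (pwq_const _ 0 (g a)) (pwq_const _ 0 0)) _ => e.
  by congr (if _ then _ else _); apply/idP/eqP => /PE.
apply: pwq_ext (@pwq_sum V 0 A (index_enum A) xpredT _ (fun a _ => h a)) _ => e.
by rewrite -big_mkcond (big_pred1 (X e)) // => a; rewrite eq_sym.
Qed.

Lemma definable_bool (V : finType) (P : env V -> bool) b : pres P -> definable (fun e => P e = b).
Proof.
move=> hP; case: b; first by exists P.
by exists (fun e => ~~ P e) => [|e]; [exact: pres_neg | split=> [/negbTE|->]].
Qed.

Definition point (k : nat) (y : int) (n : 'rV[int]_k) : env (unit + 'I_k)%type :=
  [ffun v => match v with inl _ => y | inr i => n 0 i end].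

(** * Lengths and dimensions in a constructible family *)

Section Families.
Variables (F : fieldType) (d r k : nat) (gens : 'I_r -> 'rV[int]_d) (M : 'rV[int]_k -> qmod F d).
Hypothesis cM : constructible_family gens M.

Lemma length_pwq (E : 'rV[int]_d -> Prop) : monomial_ideal gens E ->
  exists2 g : env (unit + 'I_k)%type -> rat, pwq d g &
  forall n (m L : nat), qlength gens E (M n) m L -> g (point m%:Z n) = L%:R.
Proof.
move=> idE; have [Gp [phi [_ [Gp0 [_ [phiE [N [reg [dI [psi [Tm [sreg [psiP psiT]]]]]]]]]]]]] := cM.
pose V : finType := ((unit + 'I_k) + 'I_d)%type.
pose me (e : env V) : int := e (inl (inl tt)).
pose ne (e : env V) : 'rV[int]_k := \row_i e (inl (inr i)).
pose qe (e : env V) : 'rV[int]_d := \row_j e (inr j).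
have hme : affine me by exact: affine_var.
have hne : affine_row ne by exact: affine_row_var.
have hqe : affine_row qe by exact: affine_row_var.
(* The variable for the power ranges over all integers; the guard makes its absolute value the
   actual power. Negative values are never compared with a length. *)
pose inI I (e : env V) := exists a, (0 <= me e /\ pow_exps gens E `|me e| a) /\
  reg (ne e, qe e - a) = I.
have definI I : definable (inI I).
  apply: definable_ex_row; apply: definable_and.
    have [A hA AE] := definable_pow_exps idE (affine_inl 'I_d hme) (affine_row_var (fun j => inr j)).
    apply: definable_ext (definable_and (definable_le (affine_const _ 0) (affine_inl 'I_d hme)) hA) _.
    by move=> e; split=> -[pos h]; split=> //; apply/(AE _ _ (esym (gez0_abs pos))).
  apply: definable_semisimple (sreg I) (affine_row_inl _ hne) _.
  exact: affine_row_sub (affine_row_inl _ hqe) (affine_row_var _).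
have [P presP PE] := fin_all_exists2 definI.
pose X (e : env V) := (reg (ne e, qe e), [set I | P I e]).
have defX x : definable (fun e => X e = x).
  have h1 : definable (fun e => reg (ne e, qe e) = x.1).
    exact: definable_semisimple (sreg x.1) hne hqe.
  have h2 : definable (fun e => forall I, P I e = (I \in x.2)).
    by apply: definable_all_fin => I; exact: definable_bool.
  apply: definable_ext (definable_and h1 h2) _ => e; rewrite /X.
  split=> [[e1 e2]|<-]; last by split=> // I; rewrite inE.
  case: x e1 e2 {h1 h2} => x1 x2 /= -> e2; congr pair.
  by apply/setP => I; rewrite inE e2.
pose f e := (region_colen Tm (X e))%:R : rat.
have hf : pwq 0 f by exact: (pwq_finite (fun x => (region_colen Tm x)%:R) defX).
pose s : seq V := [seq inr j | j <- enum 'I_d].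
have us : uniq s by rewrite map_inj_uniq ?enum_uniq // => i j [].
have [g hg gE] := pwq_sum_vars us hf.
have sg : (0 + size s = d)%N by rewrite size_map size_enum_ord.
rewrite sg in hg.
(* The summation formula accepts any values of the summed variables; fixing them leaves a function
   of (m, n). *)
pose zero : env 'I_d := [ffun=> 0].
exists (fun e => g (join e zero)).
  apply: pwq_comp hg => -[v|j]; first by apply: affine_ext (affine_var v) _ => e; rewrite ffunE.
  by apply: affine_ext (affine_const _ 0) _ => e; rewrite !ffunE.
move=> n m L [S [c [uS [hc [c0 ->]]]]].
pose ext (q : 'rV[int]_d) : env V := join (point m%:Z n) [ffun j => q 0 j].
have meE q : me (ext q) = m%:Z by rewrite /me !ffunE.
have neE q : ne (ext q) = n by apply/rowP => i; rewrite mxE !ffunE.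
have qeE q : qe (ext q) = q by apply/rowP => j; rewrite mxE !ffunE.
have fE q : f (ext q) = (c q)%:R.
  rewrite /f; congr (_%:R); symmetry.
  have -> : X (ext q) = (reg (n, q), [set I | P I (ext q)]) by rewrite /X neE qeE.
  apply: (colen_region Gp0 phiE psiP psiT idE _ (hc q)) => I.
  rewrite inE PE /inI meE neE qeE absz_nat.
  by split=> [[a [[_ pa] ra]]|[a pa ra]]; exists a.
rewrite (gE _ (map ext S)).
- by rewrite big_map natr_sum; apply: eq_bigr => q _; rewrite fE.
- by rewrite map_inj_uniq // => q q' /(congr1 qe); rewrite !qeE.
- move=> _ /mapP[q _ ->] [v _|j]; first by rewrite !ffunE.
  by rewrite map_f // mem_enum.
- move=> x hx xS; have xE : x = ext (qe x).
    apply/ffunP => -[v|j]; last by rewrite !ffunE mxE.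
    rewrite hx; first by rewrite !ffunE.
    by apply/mapP => -[].
  rewrite xE fE c0 //; apply: contra xS => qS.
  by rewrite xE; exact: map_f.
Qed.

Lemma definable_unbounded (T : {set 'I_r}) :
  definable (fun e : env 'I_k => unbounded gens (M (\row_i e i)) T).
Proof.
have [Gp [phi [_ [Gp0 [_ [phiE [N [reg [dI [psi [Tm [sreg [psiP psiT]]]]]]]]]]]]] := cM.
(* Vanishing of a multiplication map is read off from a pair of regions, and the choice among
   finitely many pairs is definable. The exponent is an integer variable here and is restricted to
   natural numbers afterwards. *)
pose B (e : env 'I_k) (y : int) := exists q, exists IJ : 'I_N * 'I_N,
  [/\ reg (\row_i e i, q) = IJ.1, reg (\row_i e i, q + y *: sum_gens gens T) = IJ.2 &
      Tm IJ.1 IJ.2 <> 0].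
have BP e (c : nat) : B e c%:Z <-> exists q, qact (M (\row_i e i)) q (q + sum_gens gens T *+ c) <> 0.
  have sgc q : in_sg gens (q + sum_gens gens T *+ c - q).
    by rewrite addrC addKr; apply/in_sgMn/in_sg_sum => i _; exact: in_sg_gen.
  split=> [[q [[I J] /= [h1 h2 h3]]]|[q hq]]; exists q.
    rewrite scale_posz in h2.
    by move/(qact_region_eq0 Gp0 phiE psiP psiT _ (sgc q)); rewrite h1 h2.
  exists (reg (\row_i e i, q), reg (\row_i e i, q + sum_gens gens T *+ c)).
  by rewrite scale_posz; split=> // /(qact_region_eq0 Gp0 phiE psiP psiT _ (sgc q)).
have defB : definable (fun e : env ('I_k + 'I_1)%type => B [ffun x => e (inl x)] (e (inr ord0))).
  apply: definable_ex_row; apply: definable_ex_fin => -[I J] /=.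
  pose W : finType := (('I_k + 'I_1) + 'I_d)%type.
  have hn : affine_row (fun e : env W => \row_i e (inl (inl i))) by exact: affine_row_var.
  have hq : affine_row (fun e : env W => \row_j e (inr j)) by exact: affine_row_var.
  have hy : affine_row (fun e : env W => e (inl (inr ord0)) *: sum_gens gens T).
    exact/affine_row_scale/affine_var.
  apply: definable_ext (definable_and (definable_and (definable_semisimple (sreg I) hn hq)
    (definable_semisimple (sreg J) hn (affine_row_add hq hy))) (definable_const _ (Tm I J <> 0))) _.
  move=> e; have -> : \row_i [ffun x => [ffun x0 => e (inl x0)] (inl x)] i = \row_i e (inl (inl i)).
    by apply/rowP => i; rewrite !mxE !ffunE.
  by rewrite ffunE; split=> [[[h1 h2] h3]|[h1 h2 h3]].
have h : definable (fun e : env 'I_k => exists c : 'I_1 -> nat, ~ B e (c ord0)%:Z).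
  apply: (@definable_ex_nat _ _ (fun e c => ~ B e (c ord0))).
    by move=> e c c' cc; rewrite cc.
  exact: definable_not.
apply: definable_ext (definable_not h) _ => e; split=> [nh c|ub [c]].
  by apply/BP; apply: NNPP => nB; apply: nh; exists (fun _ => c).
by apply; apply/BP; exact: ub.
Qed.

Lemma definable_qzero : definable (fun e : env 'I_k => qzero (M (\row_i e i))).
Proof.
have [Gp [phi [_ [Gp0 [_ [phiE [N [reg [dI [psi [Tm [sreg [psiP psiT]]]]]]]]]]]]] := cM.
have h : definable (fun e : env 'I_k => exists q, exists I, reg (\row_i e i, q) = I /\ dI I <> 0%N).
  apply: definable_ex_row; apply: definable_ex_fin => I.
  have hn : affine_row (fun e : env ('I_k + 'I_d)%type => \row_i e (inl i)) by exact: affine_row_var.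
  have hq : affine_row (fun e : env ('I_k + 'I_d)%type => \row_j e (inr j)) by exact: affine_row_var.
  apply: definable_ext (definable_and (definable_semisimple (sreg I) hn hq)
    (definable_const _ (dI I <> 0%N))) _ => e.
  by have -> : \row_i [ffun x => e (inl x)] i = \row_i e (inl i)
    by apply/rowP => i; rewrite !mxE !ffunE.
apply: definable_ext (definable_not h) _ => e; split=> [nh q|qz [q [I [<- dn]]]].
  rewrite (qdim_region psiP); apply: NNPP => dn; apply: nh; exists q.
  by exists (reg (\row_i e i, q)).
by apply: dn; rewrite -(qdim_region psiP).
Qed.

End Families.

Lemma iter_nabla_pwq (V : finType) (v : V) D h b : pwq D h ->
  exists2 h' : env V -> rat, pwq D h' &
    forall e y, h' (upd e v y) = iter b nabla (fun y => h (upd e v y)) y.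
Proof.
move=> hh; elim: b => [|b [h' hh' E]]; first by exists h.
exists (fun e => h' e - h' (dec v e)).
  apply: (pwq_sub hh'); apply: (pwq_comp _ hh') => u.
  exact/affine_upd/(affine_sub (affine_var v) (affine_const _ 1)).
by move=> e y; rewrite dec_upd !E.
Qed.

Theorem theorem9p30 (F : fieldType) (d r k : nat) (gens : 'I_r -> 'rV[int]_d)
    (M : 'rV[int]_k -> qmod F d) (E : 'rV[int]_d -> Prop) :
  affine_gens gens ->
  (forall n, noetherian_qmod gens (M n)) ->
  constructible_family gens M ->
  monomial_ideal gens E -> m_primary gens E ->
  forall i : nat, exists f : 'rV[int]_k -> int,
    (forall n, hilbert_coeff gens E (M n) i (f n)) /\ piecewise_quasipoly d f.
Proof.
move=> _ noeM cM idE _ i.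
have [g hg gE] := length_pwq cM idE.
have [h hh [hpoly [N N0 hlim]]] := pwq_limit (inl tt) (oner_neq0 int) hg.
pose pt (e : env 'I_k) : env (unit + 'I_k)%type := point (-1) (\row_i e i).
have hpt v : affine (fun e => pt e v).
  case: v => [u|j]; first by apply: affine_ext (affine_const _ (-1)) _ => e; rewrite ffunE.
  by apply: affine_ext (affine_var j) _ => e; rewrite ffunE mxE.
(* A rank of vectors in d coordinates is at most d, so finitely many candidate dimensions suffice.
   Each has its own formula, with the convention 0 for [i > delta]. *)
have coef (delta : 'I_d.+1) : exists2 c : env 'I_k -> rat, pwq d c &
    forall e, c e = if (i <= delta)%N then
      (-1) ^+ i * iter (delta - i) nabla (fun y => h (upd (pt e) (inl tt) y)) (-1) else 0.
  have [h' hh' E'] := iter_nabla_pwq (inl tt) (delta - i) hh.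
  exists (fun e => if (i <= delta)%N then (-1) ^+ i * h' (pt e) else 0).
    case: (i <= delta)%N; last exact: pwq_const.
    exact: pwq_scale (pwq_comp hpt hh').
  by move=> e; case: ifP => // _; rewrite -E' -{1}(upd_id (pt e) (inl tt)) [pt e _]ffunE.
have [c hc cE] := fin_all_exists2 coef.
pose dimA (delta : 'I_d.+1) (e : env 'I_k) :=
  (exists T, unbounded gens (M (\row_i e i)) T /\ gens_rank gens T = delta) /\
  (forall T, unbounded gens (M (\row_i e i)) T -> (gens_rank gens T <= delta)%N).
have defdim delta : definable (dimA delta).
  apply: definable_and.
    apply: definable_ex_fin => T; apply: definable_and (definable_const _ _).
    exact: definable_unbounded.
  apply: definable_all_fin => T; apply: definable_imp (definable_const _ _).
  exact: definable_unbounded.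
have [D presD DE] := fin_all_exists2 defdim.
have [Z presZ ZE] := definable_qzero cM.
(* The conditions [D delta] exclude one another, since each says that [delta] is the largest rank;
   the sum merely selects. *)
pose G e := if Z e then 0 else \sum_(delta < d.+1) if D delta e then c delta e else 0.
have hG : pwq d G.
  apply: pwq_if_pres presZ (pwq_const _ _ _) (pwq_sum _ _) => delta _.
  exact: pwq_if_pres (presD delta) (hc delta) (pwq_const _ _ _).
(* [G] takes integer values where the Hilbert-Samuel polynomial exists; the
   floor avoids having to prove that it always does. *)
exists (fun n => Num.floor (G (row_env n))); split; last exact: pwq_floor_quasipoly.
move=> n; have rowE : \row_i row_env n i = n by apply/rowP => j; rewrite mxE ffunE.
split=> [qz|delta es kd [m0 hs]].
  by rewrite /G ifT ?floor0 //; apply/ZE; rewrite rowE.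
have [[T unbT rkT] maxT] := krull_dim_unbounded (noeM n).1 kd.
(* Already the exponent 0 in the unboundedness of [T] yields a nonzero map out of some graded
   piece. *)
have nZ : Z (row_env n) = false.
  apply/negP => /ZE; rewrite rowE => qz; have [q] := unbT 0%N; apply.
  by apply/matrixP => a; have := ltn_ord a; rewrite {2}qz.
have ltd : (delta < d.+1)%N by rewrite ltnS -rkT rank_leq_col.
have GE : G (row_env n) = c (Ordinal ltd) (row_env n).
  rewrite /G nZ (bigD1 (Ordinal ltd)) //= ifT; last first.
    by apply/DE; rewrite /dimA rowE; split=> //; exists T.
  rewrite big1 ?addr0 // => delta' ne; case: ifP => // /DE.
  rewrite /dimA rowE => -[[T' [unb' rk']] max'].
  case/eqP: ne; apply: val_inj; apply/eqP; rewrite eqn_leq /= -rk' maxT //= rk' -rkT.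
  exact: max'.
have [p pE] := hpoly (pt (row_env n)).
have [t0 lim] := hlim (pt (row_env n)).
(* For large multiples of [N] both polynomials equal the length: [p] as the limit of [g], the other
   by the Hilbert-Samuel relation. *)
have pbin : p = \sum_(j < delta.+1) ((-1) ^+ j * (es j)%:~R) *: binp (delta - j).
  apply: (@poly_eventually_eq _ _ 1 N (maxn t0 m0)) => // t.
  rewrite geq_max => /andP[le0 le1] dv; rewrite -pE -lim // mul1r.
  have [L [qL LE]] := hs t le1.
  have -> : upd (pt (row_env n)) (inl tt) t%:Z = point t%:Z n.
    by apply/ffunP => -[[]|j]; rewrite !ffunE // mxE ffunE.
  rewrite (gE _ _ _ qL) -[L%:R]/(L%:Z%:~R) LE rmorph_sum horner_sum; apply: eq_bigr => j _.
  rewrite hornerZ !rmorphM /= rmorphXn rmorphN1; congr (_ * _).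
  by rewrite -pmulrn binp_nat addnBA // -ltnS.
have HE y : h (upd (pt (row_env n)) (inl tt) y) =
    \sum_(j < delta.+1) ((-1) ^+ j * (es j)%:~R) * (binp (delta - j)).[y%:~R].
  by rewrite pE pbin horner_sum; apply: eq_bigr => j _; rewrite hornerZ.
rewrite GE cE /=; case: ifP => [id|_]; last by rewrite floor0.
rewrite (@binp_coef delta (fun j => (-1) ^+ j * (es j)%:~R) _ i id HE).
(* The sign in [c] cancels the alternating sign of the coefficient, and the floor of the integer
   [es i] is [es i]. *)
by rewrite mulrA -exprD addnn -mul2n exprM sqrrN !expr1n mul1r intrKfloor.
Qed.
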